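(* Let $1\le p<\infty$ and let $(X,d,\mathfrak m)$ be a metric measure space, possibly non-complete. Then $$H^{1,p}_{\mathscr C,\mathrm{Lip}}(X)=H^{1,p}_{\mathscr C}(X)=H^{1,p}_{\mathrm{AGS}}(X)$$ and $$\|u\|_{H^{1,p}_{\mathscr C,\mathrm{Lip}}(X)}=\|u\|_{H^{1,p}_{\mathscr C}(X)}=\|u\|_{H^{1,p}_{\mathrm{AGS}}(X)}\qquad\text{for every }u\in L^p(X).$$
   Context: A metric measure space $(X,d,\mathfrak m)$ is a separable metric space $(X,d)$ (not necessarily complete) with a non-trivial outer measure $\mathfrak m$ which is Radon and finite on bounded sets. $\mathcal L^p(X)$ is the space of functions $u:X\to\mathbb R$ with $\int|u|^p\,d\mathfrak m<\infty$ and $L^p(X)$ is its quotient by $\mathfrak m$-a.e. equality. $\mathrm{Lip}(X)$ is the set of Lipschitz functions $X\to\mathbb R$. Relaxation. For a functional $F:\mathcal L^p(X)\to[0,+\infty]$ set $\tilde F(u):=\inf\{\liminf_{j\to\infty}F(u_j): u_j\to u \text{ in } L^p(X)\}$; it depends only on the class of $u$ in $L^p(X)$. The associated space is $H=\{u\in L^p(X):\tilde F(u)<+\infty\}$ with norm given by $\|u\|_{H}^p:=\|u\|_{L^p(X)}^p+\tilde F(u)^p$ (for $u\in L^p(X)$ outside $H$ this is $+\infty$). Chains. For $\varepsilon>0$, an $\varepsilon$-chain is a finite sequence of points $c=\{q_i\}_{i=0}^N$ of $X$ with $d(q_i,q_{i+1})\le\varepsilon$ for all $i$; $\alpha(c)=q_0$,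 $\omega(c)=q_N$. For $g:X\to[0,+\infty]$, $\int_c g:=\sum_{i=0}^{N-1}\frac{g(q_i)+g(q_{i+1})}{2}d(q_i,q_{i+1})$ (with $0\cdot\infty=0$). A Borel function $g:X\to[0,+\infty]$ is an $\varepsilon$-upper gradient of $u:X\to\mathbb R$, $g\in\mathrm{UG}^\varepsilon(u)$, if $|u(\omega(c))-u(\alpha(c))|\le\int_c g$ for every $\varepsilon$-chain $c$. Set $\mathrm{LUG}^\varepsilon(u):=\mathrm{UG}^\varepsilon(u)\cap\mathrm{Lip}(X)$. Local Lipschitz constant. $\mathrm{lip}\,u(x):=\lim_{\varepsilon\to0}\sup_{y\in B_\varepsilon(x),\,y\ne x}\frac{|u(y)-u(x)|}{d(x,y)}$ (equal to $0$ at isolated points). The spaces. With $\inf\emptyset=+\infty$, define on $\mathcal L^p(X)$: - $F_{\mathscr C}(u):=\lim_{\varepsilon\to0}\inf\{\|g\|_{L^p(X)}:g\in\mathrm{UG}^\varepsilon(u)\}$; - $F_{\mathscr C,\mathrm{Lip}}(u):=\lim_{\varepsilon\to0}\inf\{\|g\|_{L^p(X)}:g\in\mathrm{LUG}^\varepsilon(u)\}$ if $u\in\mathrm{Lip}(X)$, and $+\infty$ otherwise; - $F_{\mathrm{AGS}}(u):=\|\mathrm{lip}\,u\|_{L^p(X)}$ if $u\in\mathrm{Lip}(X)$, and $+\infty$ otherwise. The normed spaces associated by relaxation to these functionals are $H^{1,p}_{\mathscr C}(X)$, $H^{1,p}_{\mathscr C,\mathrm{Lip}}(X)$, $H^{1,p}_{\mathrm{AGS}}(X)$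 respectively. *)

(* Defs.v *)
From HB Require Import structures.
From mathcomp Require Import all_boot all_order all_algebra.
From mathcomp Require Import all_classical all_reals all_analysis.
From mathcomp Require Import measurable_realfun hoelder.

Set Implicit Arguments.
Unset Strict Implicit.
Unset Printing Implicit Defensive.
Import Order.TTheory GRing.Theory Num.Theory.
Import numFieldNormedType.Exports.

Local Open Scope classical_set_scope.
Local Open Scope ring_scope.
Local Open Scope ereal_scope.

(* The measurable types of the library carry a base point.  For a space that
   supports a non-zero measure the only content of the point is X <> set0;
   no definition below refers to it. *)
#[short(type="metricPType")]
HB.structure Definition PointedMetric (K : numDomainType) :=
  {M of Pointed M & Metric K M}.

Section metric_measure_space.
Context {R : realType} {X : metricPType R}.
Implicit Types (A K U : set X) (m : {outer_measure set X -> \bar R}).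

Definition separable : Prop := exists2 D : set X, countable D & dense D.

Definition metric_bounded A : Prop := exists (x : X) (r : R), A `<=` ball x r.

Definition radon m : Prop :=
  [/\ forall U, open U -> m.-caratheodory U,
      forall K, compact K -> m K < +oo,
      forall A, m A = ereal_inf [set m U | U in [set U | open U /\ A `<=` U]] &
      forall U, open U ->
        m U = ereal_sup [set m K | K in [set K | compact K /\ K `<=` U]]].

Definition is_metric_measure_space m : Prop :=
  [/\ separable, m [set: X] != 0, radon m &
      forall A, metric_bounded A -> m A < +oo].

(* m as a measure on its Caratheodory sigma-algebra, which contains the Borel
   sets when m is Radon. *)
Definition cara_measure m : {measure set (caratheodory_type m) -> \bar R} :=
  m : set (caratheodory_type m) -> \bar R.

(* Lfun_space consists of functions, Lp_space is its quotient by a.e. equality. *)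
Definition Lfun_space m (p : R) (p1 : 1 <= p%:E) : Type :=
  LfunType (cara_measure m) p1.
Definition Lp_space m (p : R) (p1 : 1 <= p%:E) : Type :=
  LspaceType (cara_measure m) p1.

Definition Lp_norm m (p : R) (g : X -> \bar R) : \bar R :=
  'N[cara_measure m]_(p%:E)[g].

End metric_measure_space.

Section gradients.
Context {R : realType} {X : metricPType R}.
Implicit Types (u : X -> R) (g : X -> \bar R) (eps : R).

Definition Lip u : Prop :=
  exists L : R, forall x y, (`|u x - u y| <= L * mdist x y)%R.

Definition borel g : Prop :=
  measurable_fun setT (g : g_sigma_algebraType (@open X) -> \bar R).

(* The chain q_0, ..., q_N is given by q = q_0 and s = [:: q_1; ...; q_N]. *)
Definition eps_chain eps (q : X) (s : seq X) : bool :=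
  path (fun x y => mdist x y <= eps)%R q s.

(* The product of extended reals satisfies 0 * +oo = 0. *)
Definition chain_integral g (q : X) (s : seq X) : \bar R :=
  let c := nth q (q :: s) in
  \sum_(i < size s)
    (g (c i) + g (c i.+1)) * (2^-1)%:E * (mdist (c i) (c i.+1))%:E.

Definition UG eps u : set (X -> \bar R) :=
  [set g | [/\ borel g, forall x, 0 <= g x &
    forall q s, eps_chain eps q s ->
      `|u (last q s) - u q|%:E <= chain_integral g q s]].

Definition LUG eps u : set (X -> \bar R) :=
  [set g | UG eps u g /\ exists2 h : X -> R, Lip h & g = EFin \o h].

Definition lip u (x : X) : \bar R :=
  if `[< isolated [set: X] x >] then 0 else
  lim (ereal_sup [set (`|u y - u x| / mdist x y)%:E | y in ball x e `\ x]
       @[e --> (0 : R)^'+]).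

End gradients.

Section sobolev.
Context {R : realType} {X : metricPType R}.
Variables (m : {outer_measure set X -> \bar R}) (p : R) (p1 : 1 <= p%:E).
Implicit Types (F : Lfun_space m p1 -> \bar R).

(* An element of Lp_space coerces to one of its representatives. *)
Definition relaxation F (u : Lp_space m p1) : \bar R :=
  ereal_inf [set limn_einf (fun j => F (v j)) |
    v in [set v : nat -> Lfun_space m p1 |
      Lp_norm m p (fun x => (v j x - u x)%:E) @[j --> \oo] --> 0]].

Definition H_space F : set (Lp_space m p1) := [set u | relaxation F u < +oo].

Definition H_norm F (u : Lp_space m p1) : \bar R :=
  (Lp_norm m p (fun x => (u x)%:E) `^ p + relaxation F u `^ p) `^ p^-1.

Definition F_C (u : Lfun_space m p1) : \bar R :=
  lim (ereal_inf [set Lp_norm m p g | g in UG eps u] @[eps --> (0 : R)^'+]).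

Definition F_CLip (u : Lfun_space m p1) : \bar R :=
  if `[< Lip u >] then
    lim (ereal_inf [set Lp_norm m p g | g in LUG eps u] @[eps --> (0 : R)^'+])
  else +oo.

Definition F_AGS (u : Lfun_space m p1) : \bar R :=
  if `[< Lip u >] then Lp_norm m p (lip u) else +oo.

End sobolev.

Arguments F_C {R X} m {p} p1 u.
Arguments F_CLip {R X} m {p} p1 u.
Arguments F_AGS {R X} m {p} p1 u.

(* Main.v *)
Require Import Defs.
From mathcomp Require Import all_boot all_order all_algebra.
From mathcomp Require Import all_classical all_reals all_analysis.
From mathcomp Require Import measurable_realfun hoelder.
From mathcomp Require Import ring lra.

Set Implicit Arguments.
Unset Strict Implicit.
Unset Printing Implicit Defensive.
Import Order.TTheory GRing.Theory Num.Theory.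
Import numFieldNormedType.Exports.

Local Open Scope classical_set_scope.
Local Open Scope ring_scope.

(** The relaxations of the three functionals are compared in a cycle,
    F_AGS <= F_CLip <= F_C <= F_AGS (after relaxation).  By [relaxation_le] each
    inequality reduces to one approximation: every v in L^p has, arbitrarily
    close to it in L^p, a function on which the smaller functional hardly
    exceeds the value of the larger one at v.

    F_AGS <= F_CLip.  On short chains of two points a continuous chain upper
    gradient g of v bounds the difference quotients of v by almost g, hence
    lip v <= g pointwise ([LUG_lip]).

    F_C <= F_AGS.  The largest difference quotient [slope v e x] of v at
    distance less than e from x is a lower semicontinuous, hence Borel, upper
    gradient for chains of step less than e, and it decreases to lip v as e tends to 0.  On bounded sets
    a Lipschitz v has bounded slopes and dominated convergence applies; a
    cutoff, which costs at most |v| / k, reduces to this case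
    ([F_C_approx_AGS]).

    F_CLip <= F_C is the real content ([F_CLip_approx_C]): functions and chain
    upper gradients have to be made Lipschitz at no cost.  Let g be a chain
    upper gradient of a bounded u, on a ball.  By regularity of the measure g
    has a majorant G of almost the same L^p norm that is bounded below by a
    positive constant and has compact sublevel sets ([lsc_majorant]).  Let G_n
    be the largest n-Lipschitz function below min(G, n), let S be a lower
    semicontinuous majorant of u, and let w_n(x) be the infimum of
    S(y) + int_c G_n over the chains c from x to y of step at most 1/(n+1).
    Then w_n is Lipschitz, G_n is a chain upper gradient of w_n, and w_n <= S.
    It remains to see that w_n does not fall below u in the limit
    ([chain_inf_liminf]), so that w_n is close to u in L^p.

    Almost minimal chains for w_n have bounded length, but their steps tend to
    0, so that a limit of them would be a curve, about which g says nothing.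
    Therefore only finitely many points are kept: the chain is cut into blocks
    of length about h, and of each block only the vertex v where G_n is least
    is kept.  There are boundedly many blocks, and h times the sum of G_n(v)
    is at most the chain integral ([chain_blocks]).  Compactness and lower
    semicontinuity of G give limits z_j of these points.  They must be compared
    through u and G without losing a factor, but consecutive z_j may be 2 h
    apart, since the place of v inside its block is not controlled.  Points
    whose indices differ by m, however, are at most (m+1) h apart, and the mean
    over the m ways to run through every m-th point loses only the factor
    (m+1)/m.  In formulas this mean is the telescoping sum of
    u(z_j) - u(z_(j+m)) over all j. *)

(** * Chains and their decomposition into blocks *)

Section chains.
Context {R : realType} {X : metricPType R}.
Implicit Types (x y b v q : X) (f u S : X -> R) (s : seq X) (V : seq (X * X)).

(** The real-valued version of [chain_integral], by recursion on the chain. *)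
Fixpoint chain_sum f x s : R :=
  if s is y :: s' then (f x + f y) / 2 * mdist x y + chain_sum f y s' else 0.

Lemma chain_sum_ge0 f x s : (forall y, 0 <= f y) -> 0 <= chain_sum f x s.
Proof.
move=> f0; elim: s x => //= y s IH x; rewrite addr_ge0// mulr_ge0 ?mdist_ge0//.
by rewrite divr_ge0// addr_ge0.
Qed.

(** A block is recorded by a pair: a vertex chosen in it and its last vertex,
    which is the first vertex of the next block.  All distances inside a block
    are bounded by its length. *)
Definition block_step (l : R) (a c : X * X) : bool :=
  [&& mdist a.2 c.1 <= l, mdist a.2 c.2 <= l & mdist c.1 c.2 <= l].

(** A block is closed as soon as its length reaches h, hence its length is at
    most h + e.  The value of f at the best vertex of the block, times the length
    of the block, is at most the part of the sum that belongs to the block. *)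
Lemma chain_blocks f h e x s : (forall y, 0 <= f y) -> 0 < h -> 0 <= e ->
  eps_chain e x s ->
  exists V, [/\ path (block_step (h + e)) (x, x) V,
    h * \sum_(a <- V) f a.1 <= chain_sum f x s &
    mdist (last (x, x) V).2 (last x s) <= h + e].
Proof.
move=> f0 h0 e0.
(* The chain is read from left to right: b is the start of the current block, q
   the vertex reached, v the best vertex so far, L and I the length and the sum
   accumulated in the block. *)
suff H q b v L I : mdist b v <= L -> mdist b q <= L -> mdist v q <= L ->
    f v * L <= I -> f v <= f q -> 0 <= L -> L <= h -> eps_chain e q s ->
    exists V, [/\ path (block_step (h + e)) (b, b) V,
      h * \sum_(a <- V) f a.1 <= I + chain_sum f q s &
      mdist (last (b, b) V).2 (last q s) <= h + e].
  move=> cs; have := H x x x 0 0; rewrite mdistxx mulr0 add0r; apply => //.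
  exact: ltW.
elim: s q b v L I => [|q' s IH] q b v L I bv bq vq fI fvq L0 Lh /=.
  move=> _; exists [::]; split => //=.
    rewrite big_nil mulr0 addr0 (le_trans _ fI)// mulr_ge0//.
  by rewrite (le_trans bq)// (le_trans Lh)// lerDl.
case/andP=> qq' cs.
set D := mdist q q' in qq' *.
have D0 : 0 <= D by exact: mdist_ge0.
pose v' := if f v <= f q' then v else q'.
have fv'v : f v' <= f v by rewrite /v'; case: (leP (f v)) => // /ltW.
have fv'q' : f v' <= f q' by rewrite /v'; case: (leP (f v)).
have bq' : mdist b q' <= L + D by rewrite (le_trans (metric_triangle _ q _))// lerD.
have bv' : mdist b v' <= L + D.
  by rewrite /v'; case: (leP (f v)) => // _; rewrite (le_trans bv)// lerDl.
have v'q' : mdist v' q' <= L + D.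
  rewrite /v'; case: (leP (f v)) => _; last by rewrite mdistxx addr_ge0.
  by rewrite (le_trans (metric_triangle _ q _))// lerD.
have fI' : f v' * (L + D) <= I + (f q + f q') / 2 * D.
  have := f0 v'; nra.
have [LDh|hLD] := leP (L + D) h.
  have [V [pV sV lV]] := IH q' b v' (L + D) _ bv' bq' v'q' fI' fv'q' (addr_ge0 L0 D0) LDh cs.
  by exists V; split => //; rewrite addrA.
have [||||||||V [pV sV lV]] := IH q' q' q' 0 0; rewrite ?mdistxx ?mulr0//.
  exact: ltW.
have LDhe : L + D <= h + e by rewrite lerD.
exists ((v', q') :: V); split => //=.
- rewrite /block_step/= !(le_trans _ LDhe)//=.
  by case: V pV {sV lV} => //.
- rewrite big_cons mulrDr addrA /= lerD//; last by rewrite add0r in sV.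
  rewrite (le_trans _ fI')//. have := f0 v'; nra.
- by case: V lV {pV sV}.
Qed.

(** The block ends are linked by steps of size l, so that only the first and the
    last of the m + 1 steps depend on the place of the chosen vertex in its
    block.  The sequence is continued by m copies of the first point to the left
    and by copies of the end point z to the right, so that every offset modulo m
    gives a chain from x to z. *)
Lemma block_skip l m x z V : (0 < m)%N -> 0 <= l ->
  path (block_step l) (x, x) V -> mdist (last (x, x) V).2 z <= l ->
  let W := nseq m (x, x) ++ V in
  forall j, mdist (nth (z, z) W j).1 (nth (z, z) W (j + m)).1 <= m.+1%:R * l.
Proof.
move=> m0 l0 pV lV W.
have pW : path (block_step l) (x, x) (W ++ [:: (z, z)]).
  rewrite -catA; elim: m {m0 W} => /= [|m ->].
    by rewrite cat_path pV /= /block_step /= lV mdistxx l0.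
  by rewrite /block_step/= mdistxx l0.
have st j : block_step l (nth (z, z) W j) (nth (z, z) W j.+1).
  have [jW|Wj] := ltnP j (size W); last first.
    by rewrite !nth_default ?(leqW Wj)// /block_step /= mdistxx l0.
  move: (pW) => /(pathP (z, z)) /(_ j.+1).
  rewrite size_cat addn1 ltnS => /(_ jW) /=.
  by rewrite nth_cat jW nth_cat; case: ltnP => // jW'; rewrite (nth_default _ jW') nth_seq1 if_same.
have st0 j : mdist (nth (z, z) W j).1 (nth (z, z) W j).2 <= l.
  case: j => [|j]; last by case/and3P: (st j).
  by rewrite /W; case: (m) m0 => //= _ _; rewrite mdistxx.
have bb j k : mdist (nth (z, z) W j).2 (nth (z, z) W (j + k)).2 <= k%:R * l.
  elim: k => [|k IH]; first by rewrite addn0 mdistxx mul0r.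
  rewrite addnS (le_trans (metric_triangle _ (nth (z, z) W (j + k)).2 _))//.
  rewrite -natr1 mulrDl mul1r lerD//.
  by case/and3P: (st (j + k)%N).
move=> j; case: m m0 @W pW st st0 bb => // m _ W pW st st0 bb.
rewrite (le_trans (metric_triangle _ (nth (z, z) W j).2 _))//.
rewrite -nat1r mulrDl mul1r lerD//.
rewrite (le_trans (metric_triangle _ (nth (z, z) W (j + m)).2 _))//.
rewrite -natr1 mulrDl mul1r lerD// addnS.
by case/and3P: (st (j + m)%N).
Qed.

End chains.

(** * Limits along ultrafilters *)

Lemma ultra_compact_cvg I (U : set_system I) (T : topologicalType) (A : set T)
    (y : I -> T) : UltraFilter U -> compact A -> (\forall n \near U, A (y n)) ->
  exists2 p, A p & y @ U --> p.
Proof.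
move=> UU cA UA; have PU : ProperFilter U by exact: ultra_proper.
have [p [Ap clp]] := cA (y @ U) _ UA.
exists p => // B Bp; have [//|nB] := in_ultra_setVsetC (y @^-1` B) UU.
by have [z [] /=] := clp (~` B) B nB Bp.
Qed.

Lemma ultra_bounded_nat I (U : set_system I) (k : I -> nat) N :
  UltraFilter U -> (\forall n \near U, (k n < N)%N) ->
  exists c, \forall n \near U, k n = c.
Proof.
move=> UU; have PU : ProperFilter U by exact: ultra_proper.
elim: N => [|N IH] kN; first by have [n] := filter_ex kN; rewrite ltn0.
have [kN'|kN'] := in_ultra_setVsetC [set n | k n = N] UU; first by exists N.
apply: IH; apply: filterS2 kN kN' => n /=; rewrite ltnS leq_eqVlt.
by case/orP => // /eqP.
Qed.

(** * Lipschitz regularization from below *)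

Section regularization.
Context {R : realType} {X : metricPType R}.
Variable G : X -> \bar R.
Hypothesis G0 : forall y, (0 <= G y)%E.

Definition capped n y : R := fine (mine (G y) n%:R%:E).

(** The largest n-Lipschitz function below min(G, n). *)
Definition lip_reg n x : R :=
  inf [set capped n y + n%:R * mdist x y | y in [set: X]].

Lemma cappedE n y : (capped n y)%:E = mine (G y) n%:R%:E.
Proof.
rewrite /capped fineK// ge0_fin_numE; last by rewrite le_min G0 lee_fin ler0n.
by rewrite (le_lt_trans _ (ltry n%:R))// ge_min lexx orbT.
Qed.

Lemma capped_le n y : ((capped n y)%:E <= G y)%E.
Proof. by rewrite cappedE ge_min lexx. Qed.

Lemma capped_len n y : capped n y <= n%:R.
Proof. by rewrite -lee_fin cappedE ge_min lexx orbT. Qed.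

Lemma capped_ge a n y : (a%:E <= G y)%E -> a <= n%:R -> a <= capped n y.
Proof. by move=> aG an; rewrite -lee_fin cappedE le_min aG lee_fin. Qed.

Lemma capped_lt n y : capped n y < n%:R -> G y = (capped n y)%:E.
Proof.
by rewrite -lte_fin cappedE; case: (leP (G y)) => //; rewrite ltxx.
Qed.

Let reg_has n x : has_inf [set capped n y + n%:R * mdist x y | y in [set: X]].
Proof.
split; first by exists (capped n x + n%:R * mdist x x), x.
exists 0 => _ [y _ <-]; rewrite addr_ge0 ?mulr_ge0 ?mdist_ge0//.
by rewrite capped_ge.
Qed.

Lemma lip_reg_le n x y : lip_reg n x <= capped n y + n%:R * mdist x y.
Proof. by apply: ge_inf; [case: (reg_has n x)|exists y]. Qed.

Lemma lip_reg_ge a n x : (forall y, (a%:E <= G y)%E) -> a <= n%:R ->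
  a <= lip_reg n x.
Proof.
move=> aG an; apply: lb_le_inf; first by case: (reg_has n x).
by move=> _ [y _ <-]; rewrite ler_wpDr ?mulr_ge0 ?mdist_ge0// capped_ge.
Qed.

Lemma lip_reg_ge0 n x : 0 <= lip_reg n x.
Proof. exact: lip_reg_ge. Qed.

Lemma lip_reg_leG n x : ((lip_reg n x)%:E <= G x)%E.
Proof.
rewrite (le_trans _ (capped_le n x))// lee_fin.
by have := lip_reg_le n x x; rewrite mdistxx mulr0 addr0.
Qed.

Lemma lip_reg_len n x : lip_reg n x <= n%:R.
Proof.
rewrite (le_trans _ (capped_len n x))//.
by have := lip_reg_le n x x; rewrite mdistxx mulr0 addr0.
Qed.

Lemma lip_reg_lip n x y : `|lip_reg n x - lip_reg n y| <= n%:R * mdist x y.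
Proof.
suff H a b : lip_reg n a - n%:R * mdist a b <= lip_reg n b.
  rewrite ler_norml; have := H x y; have := H y x; rewrite metric_sym; lra.
apply: lb_le_inf; first by case: (reg_has n b).
move=> _ [z _ <-]; rewrite lerBlDr -addrA -mulrDr.
rewrite (le_trans (lip_reg_le n a z))// lerD2l ler_wpM2l// addrC.
exact: metric_triangle.
Qed.

Lemma lip_reg_adherent n x e : 0 < e ->
  exists y, capped n y + n%:R * mdist x y < lip_reg n x + e.
Proof.
by move=> e0; have [_ [y _ <-] ye] := inf_adherent e0 (reg_has n x); exists y.
Qed.

Hypothesis cG : forall a : R, compact [set y | (G y <= a%:E)%E].

(** The regularizations inherit compactness from G in the limit: the infimum that
    defines lip_reg n (q n) is almost attained at a point y n of a fixed sublevel
    set of G, at distance O(1/n) from q n. *)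
Lemma lip_reg_ultra (U : set_system nat) (q : nat -> X) (B : R) :
  UltraFilter U -> \oo `<=` U -> (\forall n \near U, lip_reg n (q n) <= B) ->
  exists y a, [/\ q @ U --> y, lip_reg n (q n) @[n --> U] --> a &
    (G y <= a%:E)%E].
Proof.
move=> UU Uoo UB; have PU : ProperFilter U by exact: ultra_proper.
have /boolp.choice[y Hy] n : exists y,
    capped n y + n%:R * mdist (q n) y < lip_reg n (q n) + n.+1%:R^-1.
  by apply: lip_reg_adherent; rewrite invr_gt0.
have Uinv e : 0 < e -> \forall n \near U, n.+1%:R^-1 < e :> R.
  by move=> e0; apply: Uoo; exact: near_infty_natSinv_lt (PosNum e0).
have Ularge (M : R) : \forall n \near U, M < n%:R.
  by apply: Uoo; exact: nbhs_infty_gtr.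
have UG : \forall n \near U, (G (y n) <= (lip_reg n (q n) + n.+1%:R^-1)%:E)%E.
  near=> n.
  have cl : capped n (y n) < lip_reg n (q n) + n.+1%:R^-1.
    by apply: le_lt_trans (Hy n); rewrite lerDl mulr_ge0// mdist_ge0.
  have B1 : lip_reg n (q n) + n.+1%:R^-1 < B + 1.
    by rewrite ler_ltD//; near: n => //; apply: Uinv.
  rewrite (@capped_lt n); first by rewrite lee_fin ltW.
  by rewrite (lt_trans (lt_trans cl B1))//; near: n; exact: Ularge.
have [p _ yp] : exists2 p, [set y | (G y <= (B + 1)%:E)%E] p & y @ U --> p.
  apply: ultra_compact_cvg => //; near=> n.
  apply: (@le_trans _ _ (lip_reg n (q n) + n.+1%:R^-1)%:E).
    by near: n.
  rewrite lee_fin lerD//; first by near: n.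
  by near: n; apply: filterS (Uinv _ ltr01) => n /ltW.
have [a _ ra] : exists2 a, `[0, B]%classic a & lip_reg n (q n) @[n --> U] --> a.
  apply: ultra_compact_cvg => //; first exact: segment_compact.
  by near=> n; rewrite /= in_itv/= lip_reg_ge0/=; near: n.
exists p, a; split => //.
  apply/metricType_numDomainType.cvgrPdist_lt => e e0; near=> n.
  have yn : mdist p (y n) < e / 2.
    by near: n; apply: (metricType_numDomainType.cvgr_dist_lt yp); rewrite divr_gt0.
  have H1 : n%:R * mdist (q n) (y n) <= B + 1.
    apply/ltW/(le_lt_trans _ (lt_le_trans (Hy n) _)).
      by rewrite lerDr capped_ge.
    by rewrite lerD//; [near: n|apply: ltW; near: n; exact: Uinv].
  have nB : (B + 1) / (e / 2) < n%:R by near: n; exact: Ularge.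
  have n0 : 0 < n%:R :> R by near: n; exact: Ularge.
  have : mdist (q n) (y n) < e / 2.
    rewrite -(ltr_pM2l n0) (le_lt_trans H1)// -ltr_pdivrMr// divr_gt0//.
  move=> qy; rewrite (le_lt_trans (metric_triangle _ (y n) _))//.
  by rewrite [ltRHS]splitr ltrD// metric_sym.
apply/lee_addgt0Pr => e e0; rewrite -EFinD.
apply: (closed_cvg [set z | (G z <= (a + e)%:E)%E] _ _ _ yp).
  by apply: compact_closed => //; exact: metric_hausdorff.
near=> n; rewrite /= (@le_trans _ _ (lip_reg n (q n) + n.+1%:R^-1)%:E)//.
  by near: n.
rewrite lee_fin (splitr e) addrA lerD//.
  have : `|a - lip_reg n (q n)| < e / 2.
    by near: n; apply: cvgr_dist_lt => //; rewrite divr_gt0.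
  by rewrite ltr_norml; lra.
by apply/ltW; near: n; apply: Uinv; rewrite divr_gt0.
Unshelve. all: by end_near. Qed.

End regularization.

(** * Infima over chains *)

Section chain_inf.
Context {R : realType} {X : metricPType R}.
Variables (f S : X -> R) (M e : R).
Hypotheses (f0 : forall x, 0 <= f x) (SM : forall x, - M <= S x).

(** The chains start at x, and S is evaluated at their other end. *)
Definition chain_inf x : R :=
  inf [set S (last x s) + chain_sum f x s | s in [set s | eps_chain e x s]].

Let chain_has x :
  has_inf [set S (last x s) + chain_sum f x s | s in [set s | eps_chain e x s]].
Proof.
split; first by exists (S x + 0), [::].
exists (- M) => _ [s _ <-].
by rewrite -[leLHS]addr0 lerD//; exact: chain_sum_ge0.
Qed.

Lemma chain_inf_le x s : eps_chain e x s ->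
  chain_inf x <= S (last x s) + chain_sum f x s.
Proof. by move=> cs; apply: ge_inf; [case: (chain_has x)|exists s]. Qed.

Lemma chain_inf_leS x : chain_inf x <= S x.
Proof. by have := @chain_inf_le x [::] isT; rewrite /= addr0. Qed.

Lemma chain_inf_ge x : - M <= chain_inf x.
Proof.
apply: lb_le_inf; first by case: (chain_has x).
by move=> _ [s _ <-]; rewrite -[leLHS]addr0 lerD//; exact: chain_sum_ge0.
Qed.

(** A step from x to y may be put in front of any chain that starts at y. *)
Lemma chain_inf_step x y : mdist x y <= e ->
  `|chain_inf x - chain_inf y| <= (f x + f y) / 2 * mdist x y.
Proof.
move=> xye; suff H a b : mdist a b <= e ->
    chain_inf a - (f a + f b) / 2 * mdist a b <= chain_inf b.
  have := H x y xye; have := H y x; rewrite metric_sym (addrC (f y)) ler_norml.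
  by move=> /(_ xye); lra.
move=> abe; apply: lb_le_inf; first by case: (chain_has b).
move=> _ [s cs <-]; rewrite lerBlDr -addrA (addrC (chain_sum _ _ _)).
by apply: (@chain_inf_le a (b :: s)); rewrite /eps_chain/= abe.
Qed.

Lemma chain_inf_lt x a : chain_inf x < a ->
  exists s, eps_chain e x s /\ S (last x s) + chain_sum f x s < a.
Proof.
rewrite -subr_gt0 => xa; have [_ [s cs <-] sa] := inf_adherent xa (chain_has x).
by exists s; split => //; rewrite subrKC in sa.
Qed.

End chain_inf.

(** * Convergence of the infima over chains *)

Section padding.
Variables (T : Type) (m k : nat) (A : T) (Y : nat -> T) (E : T).

(** The sequence A, ..., A, Y 0, ..., Y (k-1), E, E, ... with m copies of A. *)
Definition pad j := if (j < m)%N then A else if (j < m + k)%N then Y (j - m) else E.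

Lemma nth_pad V : size V = k -> (forall i, (i < k)%N -> nth E V i = Y i) ->
  forall j, nth E (nseq m A ++ V) j = pad j.
Proof.
move=> sV VY j; rewrite nth_cat size_nseq nth_nseq /pad.
have [//|mj] := ltnP j m.
have -> : (j < m + k)%N = (j - m < k)%N by rewrite ltn_subLR.
by case: ltnP => [/VY//|kj]; rewrite nth_default// sV.
Qed.

End padding.

Lemma map_pad T T' (g : T -> T') m k A Y E j :
  g (pad m k A Y E j) = pad m k (g A) (g \o Y) (g E) j.
Proof. by rewrite /pad; case: ifP => // _; case: ifP. Qed.

Lemma sum_pad (R : realType) m k (A E : R) Y :
  \sum_(j < m + k) pad m k A Y E j = m%:R * A + \sum_(i < k) Y i.
Proof.
rewrite big_split_ord/=; congr (_ + _).
  under eq_bigr do rewrite /pad/= ltn_ord.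
  by rewrite sumr_const card_ord mulr_natl.
apply: eq_bigr => i _; rewrite /pad/= ltnNge leq_addr/= ltn_add2l ltn_ord.
by rewrite addKn.
Qed.

Lemma sum_pad_shift (R : realType) m k (A E : R) Y :
  \sum_(j < m + k) pad m k A Y E (j + m) = \sum_(i < k) Y i + m%:R * E.
Proof.
have -> : \sum_(j < m + k) pad m k A Y E (j + m) =
          \sum_(j < k + m) pad m k A Y E (j + m).
  by rewrite -(big_mkord xpredT (fun j => pad m k A Y E (j + m))) addnC big_mkord.
rewrite big_split_ord/=; congr (_ + _).
  apply: eq_bigr => i _; rewrite /pad/= ltnNge leq_addl/= addnC ltn_add2l.
  by rewrite ltn_ord addKn.
rewrite (eq_bigr (fun=> E)) => [|i _].
  by rewrite sumr_const card_ord mulr_natl.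
by rewrite /pad/= ltnNge leq_addl/= addnC ltn_add2l ltnNge leq_addr.
Qed.

Lemma not_near_ultra I (F : set_system I) (A : set I) : Filter F -> ~ F A ->
  exists U : set_system I, [/\ UltraFilter U, F `<=` U & U (~` A)].
Proof.
move=> FF FA; have PW : ProperFilter (within (~` A) F).
  apply: Build_ProperFilter_ex => P FP; apply: contrapT => nP.
  apply: FA; move: FP; rewrite /within/=; apply: filterS => i Pi.
  by apply: contrapT => /Pi Pi'; apply: nP; exists i.
have [U [UU WU]] := ultraFilterLemma PW.
exists U; split => //; last by apply: WU; exact: nearW.
by move=> B FB; apply: WU; exact: filterS FB => i Bi _.
Qed.

(** The arithmetic that ends the next proof: the mean over m offsets bounds T by
    (m + 1) / m times the limit of the sums, up to an error that is small with h,
    while these sums are at most T - d. *)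
Lemma telescope_contra (R : realFieldType) (m T h s C d M : R) : 0 <= m ->
  m * T <= (m + 1) * h * (s + m * C) -> h * s <= T - d -> h * m * C < d / 2 ->
  T <= 2 * M -> 2 * M < (m + 1) * d / 2 -> False.
Proof.
move=> m0 mT hs hmC TM Md.
have : (m + 1) * (h * s + h * m * C) <= (m + 1) * (T - d / 2).
  by apply: ler_wpM2l; lra.
lra.
Qed.

Section liminf.
Context {R : realType} {X : metricPType R}.
Variables (G : X -> \bar R) (S u : X -> R) (M C eta eps : R).
Hypotheses (eta0 : 0 < eta) (etaG : forall y, (eta%:E <= G y)%E).
Hypothesis cG : forall a : R, compact [set y | (G y <= a%:E)%E].
Hypothesis eps0 : 0 < eps.
Hypothesis uG : forall x y a b, mdist x y <= eps ->
  (G x <= a%:E)%E -> (G y <= b%:E)%E ->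
  `|u x - u y| <= (a + b) / 2 * mdist x y.
Hypotheses (SM : forall x, - M <= S x <= M) (uM : forall x, `|u x| <= M).
Hypothesis clS : forall a, closed [set x | S x <= a].
Hypothesis uS : forall x, (G x <= C%:E)%E -> u x <= S x.
Hypothesis SC : forall x, S x < M -> (G x <= C%:E)%E.

Let G0 y : (0 <= G y)%E.
Proof. by rewrite (le_trans _ (etaG y))// lee_fin ltW. Qed.

(** Were the infima below u x - d for infinitely many n, almost minimal chains
    would, along an ultrafilter, have limit points z_j to which the hypothesis
    [uG] applies; the sum of these inequalities is absurd for suitable m and h. *)
Lemma chain_inf_liminf x d : (G x <= C%:E)%E -> 0 < d ->
  \forall n \near \oo, u x - d <= chain_inf (lip_reg G n) S n.+1%:R^-1 x.
Proof.
move=> GxC d0; apply: contrapT => /not_near_ultra[U [UU Uoo Ux]].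
have PU : ProperFilter U by exact: ultra_proper.
have Uinv e : 0 < e -> \forall n \near U, n.+1%:R^-1 < e :> R.
  by move=> e0; apply: Uoo; exact: near_infty_natSinv_lt (PosNum e0).
have Ularge (A : R) : \forall n \near U, A < n%:R.
  by apply: Uoo; exact: nbhs_infty_gtr.
have SM1 y : - M <= S y by case/andP: (SM y).
have C0 : 0 < C by rewrite -lte_fin (lt_le_trans _ GxC)// (lt_le_trans _ (etaG x)).
have M0 : 0 <= M by exact: le_trans (uM x).
(* First m is taken large, to make the loss of the factor (m + 1) / m harmless;
   then h is taken small with respect to m, to make negligible the cost of the
   first and last m jumps, whose ends lie in the set where G <= C. *)
have [m m0 mM] : exists2 m, (0 < m)%N & 2 * M < m.+1%:R * d / 2.
  exists (Num.truncn (4 * M / d)).+1 => //.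
  have := truncnS_gt (4 * M / d); rewrite ltr_pdivrMr//.
  by rewrite -(@natr1 R (Num.truncn (4 * M / d)).+1); set t := (_.+1%:R); lra.
have [h h0 [hC heps]] : exists2 h, 0 < h & h * m%:R * C < d / 2 /\ m.+1%:R * h <= eps.
  have m0' : 0 < m%:R :> R by rewrite ltr0n.
  exists (Num.min (d / 4 / (m%:R * C)) (eps / m.+1%:R)).
    by rewrite lt_min !divr_gt0// mulr_gt0.
  split.
    rewrite -mulrA -ltr_pdivlMr ?mulr_gt0// gt_min; apply/orP; left.
    by rewrite ltr_pM2r ?invr_gt0 ?mulr_gt0//; lra.
  by rewrite mulrC -ler_pdivlMr// ge_min lexx orbT.
have /boolp.choice[s Hs] n : exists s, chain_inf (lip_reg G n) S n.+1%:R^-1 x < u x - d ->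
    eps_chain n.+1%:R^-1 x s /\ S (last x s) + chain_sum (lip_reg G n) x s < u x - d.
  have [wx|] := ltP; last by exists [::].
  by have [s Hs] := chain_inf_lt (lip_reg_ge0 G0 n) SM1 wx; exists s.
pose e n := last x (s n).
have {Ux} Us : \forall n \near U, eps_chain n.+1%:R^-1 x (s n) /\
    S (e n) + chain_sum (lip_reg G n) x (s n) < u x - d.
  apply: filterS Ux => n /= nx; apply: Hs; rewrite ltNge; exact/negP.
have /boolp.choice[V HV] n : exists V, eps_chain n.+1%:R^-1 x (s n) ->
    [/\ path (block_step (h + n.+1%:R^-1)) (x, x) V,
    h * \sum_(a <- V) lip_reg G n a.1 <= chain_sum (lip_reg G n) x (s n) &
    mdist (last (x, x) V).2 (e n) <= h + n.+1%:R^-1].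
  have [|] := pselect (eps_chain n.+1%:R^-1 x (s n)); last by exists [::].
  have e0 : 0 <= n.+1%:R^-1 :> R by rewrite invr_ge0.
  by move=> /(chain_blocks (lip_reg_ge0 G0 n) h0 e0)[V HV]; exists V.
have Usum : \forall n \near U, S (e n) + h * \sum_(a <- V n) lip_reg G n a.1 <= u x - d.
  apply: filterS Us => n [/HV[_ hs _] /ltW]; apply: le_trans.
  by rewrite lerD2l.
have sum0 n : 0 <= h * \sum_(a <- V n) lip_reg G n a.1.
  by rewrite mulr_ge0 ?(ltW h0)// sumr_ge0// => a _; exact: lip_reg_ge0.
have UsumM : \forall n \near U, h * \sum_(a <- V n) lip_reg G n a.1 <= 2 * M.
  apply: filterS Usum => n; have := SM1 (e n).
  have := uM x; rewrite ler_norml => /andP[_]; lra.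
have Ue : \forall n \near U, (G (e n) <= C%:E)%E.
  apply: filterS Usum => n Hn; apply: SC.
  have := sum0 n; have := uM x; rewrite ler_norml => /andP[_]; lra.
(* Every block costs at least h * eta, hence the number of blocks is bounded and
   therefore constant along the ultrafilter. *)
have [k Uk] : exists k, \forall n \near U, size (V n) = k.
  apply: (@ultra_bounded_nat _ _ _ (Num.truncn (2 * M / (h * eta))).+1) => //.
  near=> n; rewrite -(ltr_nat R) (le_lt_trans _ (truncnS_gt _))//.
  rewrite ler_pdivlMr ?mulr_gt0//.
  have : h * \sum_(a <- V n) lip_reg G n a.1 <= 2 * M by near: n.
  apply: le_trans; rewrite mulrCA ler_pM2l// mulr_natl.
  rewrite -sum1_size -sumrMnr ler_sum// => a _; apply: lip_reg_ge => //.
  by apply: ltW; near: n; exact: Ularge.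
have /boolp.choice[Y /boolp.choice[a HY]] i : exists y a, (i < k)%N ->
    [/\ (nth (e n, e n) (V n) i).1 @[n --> U] --> y,
    lip_reg G n (nth (e n, e n) (V n) i).1 @[n --> U] --> a & (G y <= a%:E)%E].
  have [ik|_] := ltnP i k; last by exists x, 0.
  have [] := @lip_reg_ultra _ _ G G0 cG U (fun n => (nth (e n, e n) (V n) i).1) (2 * M / h) UU Uoo.
    near=> n; rewrite ler_pdivlMr// mulrC.
    have : h * \sum_(a <- V n) lip_reg G n a.1 <= 2 * M by near: n.
    apply: le_trans; rewrite ler_pM2l//.
    have iV : (i < size (V n))%N by have -> : size (V n) = k by near: n.
    rewrite (big_nth (e n, e n)) big_mkord (bigD1 (Ordinal iV))//= lerDl.
    by rewrite sumr_ge0// => j _; exact: lip_reg_ge0.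
  by move=> y [b Hb]; exists y, b.
(* S (e n) < M forces the end points e n into a compact sublevel set of G. *)
have [E GE eE] : exists2 E, (G E <= C%:E)%E & e @ U --> E.
  by apply: (@ultra_compact_cvg _ U _ [set y | (G y <= C%:E)%E]).
have [sg _ Ssg] : exists2 sg, `[- M, M]%classic sg & S (e n) @[n --> U] --> sg.
  apply: ultra_compact_cvg => //; first exact: segment_compact.
  by apply: nearW => n; rewrite /= in_itv/=; exact: SM.
have SE : S E <= sg.
  apply/ler_addgt0Pr => r r0.
  apply: (closed_cvg [set y | S y <= sg + r] _ _ _ eE); first exact: clS.
  near=> n => /=; have : `|sg - S (e n)| < r.
    by near: n; apply: cvgr_dist_lt.
  by rewrite ltr_norml => /andP[]; lra.
have lim_sum : sg + h * \sum_(i < k) a i <= u x - d.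
  have cv : S (e n) + h * \sum_(i < k) lip_reg G n (nth (e n, e n) (V n) i).1 @[n --> U]
      --> sg + h * \sum_(i < k) a i.
    apply: cvgD => //; apply: cvgMr; apply: cvg_big => [|i _].
      exact: add_continuous.
    by have [] := HY i (ltn_ord i).
  apply: (closed_cvg [set y | y <= u x - d] _ _ _ cv); first exact: closed_le.
  near=> n => /=; have <- : size (V n) = k by near: n.
  rewrite -(big_mkord xpredT (fun i => lip_reg G n (nth (e n, e n) (V n) i).1)).
  by rewrite -(big_nth (e n, e n) xpredT (fun v => lip_reg G n v.1)); near: n.
(* z is the sequence of limit points and b bounds G along it. *)
pose z := pad m k x Y E; pose b := pad m k C a C.
have Gz j : (G (z j) <= (b j)%:E)%E.
  rewrite /z /b /pad; case: ifP => // /negbT; rewrite -leqNgt => mj.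
  case: ifP => // jk; have [] // := HY (j - m)%N.
  by rewrite ltn_subLR.
pose zn n := fun j => (nth (e n, e n) (nseq m (x, x) ++ V n) j).1.
have zlim j : zn n j @[n --> U] --> z j.
  have : (pad m k x (fun i => (nth (e n, e n) (V n) i).1) (e n) j) @[n --> U] --> z j.
    rewrite /z /pad; case: ifP => [_|/negbT]; first exact: cvg_cst.
    rewrite -leqNgt => mj.
    case: ifP => // jk; have [] // := HY (j - m)%N.
    by rewrite ltn_subLR.
  apply: cvg_trans; apply: near_eq_cvg; near=> n.
  rewrite /zn (@nth_pad _ m k (x, x) (nth (e n, e n) (V n)))//.
    by rewrite (map_pad fst).
  by near: n.
have zstep j : mdist (z j) (z (j + m)%N) <= m.+1%:R * h.
  apply/ler_addgt0Pr => r r0; have r3 : 0 < r / 3 by rewrite divr_gt0.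
  near U => n.
  have z1 : mdist (z j) (zn n j) < r / 3.
    by near: n; apply: (metricType_numDomainType.cvgr_dist_lt (zlim j)).
  have z2 : mdist (z (j + m)%N) (zn n (j + m)%N) < r / 3.
    by near: n; apply: (metricType_numDomainType.cvgr_dist_lt (zlim (j + m)%N)).
  have z3 : mdist (zn n j) (zn n (j + m)%N) <= m.+1%:R * (h + n.+1%:R^-1).
    have [/HV[pV _ lV] _] : eps_chain n.+1%:R^-1 x (s n) /\
        S (e n) + chain_sum (lip_reg G n) x (s n) < u x - d by near: n.
    apply: (block_skip m0 _ pV lV).
    by rewrite addr_ge0// ?ltW.
  have z4 : m.+1%:R * n.+1%:R^-1 < r / 3 :> R.
    rewrite mulrC -ltr_pdivlMr//; near: n; apply: Uinv.
    by rewrite divr_gt0.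
  rewrite (le_trans (metric_triangle _ (zn n j) _))//.
  have := metric_triangle (zn n j) (zn n (j + m)%N) (z (j + m)%N).
  rewrite (metric_sym (zn n (j + m)%N)); move: z3 z4; rewrite mulrDr.
  move: (_ * n.+1%:R^-1) (_ * h) => A B; lra.
have tel : \sum_(j < m + k) (u (z j) - u (z (j + m)%N)) = m%:R * (u x - u E).
  rewrite sumrB /z; under eq_bigr do rewrite (map_pad u).
  under [X in _ - X]eq_bigr do rewrite (map_pad u).
  by rewrite sum_pad sum_pad_shift; ring.
have ubd : m%:R * (u x - u E) <= m.+1%:R * h * (\sum_(i < k) a i + m%:R * C).
  rewrite -tel; apply: (@le_trans _ _
      (\sum_(j < m + k) (b j + b (j + m)%N) / 2 * (m.+1%:R * h))).
    apply: ler_sum => j _; apply: (le_trans (ler_norm _)).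
    apply: (le_trans (uG _ (Gz j) (Gz (j + m)%N))).
      exact: le_trans (zstep j) heps.
    have b0 i : 0 <= b i by rewrite -lee_fin (le_trans _ (Gz i)).
    by rewrite ler_wpM2l// divr_ge0// addr_ge0.
  rewrite -mulr_suml -mulr_suml big_split/= sum_pad sum_pad_shift.
  rewrite le_eqVlt; apply/orP; left; apply/eqP.
  by set A := \sum_(i < k) a i; set B := m.+1%:R; field.
have uE : u E <= S E by exact: uS.
have T2M : u x - u E <= 2 * M.
  have := uM x; have := uM E; rewrite !ler_norml => /andP[? ?] /andP[? ?]; lra.
have m1 : m.+1%:R = m%:R + 1 :> R by rewrite natr1.
move: ubd lim_sum hC mM; rewrite m1.
set T := u x - u E in T2M *; set sa := \sum_(i < k) a i; set mr := m%:R.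
move=> ubd lim_sum hC mM.
have mr0 : 0 <= mr by rewrite ler0n.
have hs : h * sa <= T - d by rewrite /T; lra.
exact: telescope_contra mr0 ubd hs hC T2M mM.
Unshelve. all: by end_near. Qed.

End liminf.

(** * Borel functions and Radon measures *)

Section borel.
Context {R : realType} {X : metricPType R}.
Implicit Types (m : {outer_measure set X -> \bar R}) (A K Y : set X).

Lemma lsc_borel (f : X -> \bar R) :
  (forall a : R, open [set x | (a%:E < f x)%E]) -> borel f.
Proof.
move=> fo; apply: (measurability _ (ErealGenOInfty.measurableE R)).
move=> _ [_ [r ->] <-]; apply: sub_sigma_algebra; rewrite setTI.
by rewrite (_ : _ @^-1` _ = [set x | (r%:E < f x)%E])//;
  apply/seteqP; split => x /=; rewrite in_itv/= andbT.
Qed.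

Lemma open_metric_ball (x : X) (r : R) :
  open (ball x r).
Proof.
rewrite openE => y; rewrite ballEmdist /= => xy.
apply/metricType_numDomainType.nbhs_mdistP; exists (r - mdist x y) => /=.
  by rewrite subr_gt0.
move=> z /=; by have := metric_triangle x y z; lra.
Qed.

Lemma open_cara m A : radon m -> open A ->
  measurable (A : set (caratheodory_type m)).
Proof. by case=> oc _ _ _ /oc. Qed.

Lemma closed_cara m A : radon m -> closed A ->
  measurable (A : set (caratheodory_type m)).
Proof.
move=> rm cA; rewrite -(setCK A); apply: measurableC.
by apply: open_cara => //; exact: closed_openC.
Qed.

Lemma borel_cara m (f : X -> \bar R) : radon m -> borel f ->
  measurable_fun setT (f : caratheodory_type m -> \bar R).
Proof.
move=> rm bf _ B mB; have := bf measurableT B mB.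
rewrite !setTI => Bf; suff: <<s @open X >> `<=`
    (measurable : set (set (caratheodory_type m))) by exact.
apply: smallest_sub; first exact: sigma_algebra_measurable.
by move=> A oA; exact: open_cara.
Qed.

Lemma radon_open_outer m A (e : R) : radon m -> (m A < +oo)%E -> 0 < e ->
  exists W, [/\ open W, A `<=` W & (m W <= m A + e%:E)%E].
Proof.
move=> [_ _ outer _] mA e0.
have [|_ [W [oW AW] <-] lW] :=
  @lb_ereal_inf_adherent _ [set m U | U in [set U | open U /\ A `<=` U]] _ e0.
  by rewrite -outer ge0_fin_numE//; exact: outer_measure_ge0.
by exists W; split => //; rewrite (outer A) ltW.
Qed.

Lemma radon_compact_inner m Y (e : R) : radon m -> open Y -> (m Y < +oo)%E ->
  0 < e -> exists K, [/\ compact K, K `<=` Y & (m (Y `\` K) <= e%:E)%E].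
Proof.
move=> rm oY mY e0; have [_ _ _ /(_ _ oY) inner] := rm.
have mYf : m Y \is a fin_num by rewrite ge0_fin_numE//; exact: outer_measure_ge0.
have [|_ [K [cK KY] <-] lK] :=
  @ub_ereal_sup_adherent _ [set m K | K in [set K | compact K /\ K `<=` Y]] _ e0.
  by rewrite -inner.
exists K; split => //.
have mK : measurable (K : set (caratheodory_type m)).
  by apply: closed_cara => //; apply: compact_closed => //; exact: metric_hausdorff.
have mYm : measurable (Y : set (caratheodory_type m)) by exact: open_cara.
have := measureD (mu := cara_measure m) mYm mK mY.
rewrite /cara_measure/= => ->.
rewrite (setIidr KY) leeBlDr; last first.
  rewrite ge0_fin_numE ?outer_measure_ge0// (le_lt_trans _ mY)//.
  exact: le_outer_measure.
by rewrite -leeBlDl// inner ltW.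
Qed.

Lemma compact_sublevel_borel (f : X -> \bar R) :
  (forall a : R, compact [set x | (f x <= a%:E)%E]) -> borel f.
Proof.
move=> cf; apply: lsc_borel => a.
have -> : [set x | (a%:E < f x)%E] = ~` [set x | (f x <= a%:E)%E].
  by apply/seteqP; split => x /=; rewrite ltNge => /negP.
by apply: closed_openC; apply: compact_closed => //; exact: metric_hausdorff.
Qed.

End borel.

(** * Lower semicontinuous majorants *)

Section majorant.
Context {R : realType} {X : metricPType R}.
Variables (m : {outer_measure set X -> \bar R}) (Y : set X).
Hypotheses (rm : radon m) (oY : open Y) (mY : (m Y < +oo)%E).
Let T := caratheodory_type m.
Let mu := cara_measure m.

Let mYm : measurable (Y : set T). Proof. exact: open_cara. Qed.

Let finY A : A `<=` Y -> (m A < +oo)%E.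
Proof. by move=> AY; rewrite (le_lt_trans _ mY)//; exact: le_outer_measure. Qed.

(** Outer regularity gives an open set around A, the null set N and the part of Y
    outside a large compact set K; adding the complement of K makes the
    complement of the open set compact. *)
Lemma radon_open_cell (A N : set X) (e : R) :
  A `<=` Y -> N `<=` Y -> m N = 0%E -> 0 < e ->
  exists U K, [/\ open U, compact K, K `<=` Y, ~` K `<=` U &
    A `|` N `<=` U /\ (m (U `&` Y) <= m A + e%:E)%E].
Proof.
move=> AY NY mN e0; have e2 : 0 < e / 2 by rewrite divr_gt0.
have [K [cK KY mYK]] := radon_compact_inner rm oY mY e2.
have cmK : closed K by apply: compact_closed => //; exact: metric_hausdorff.
pose B := (A `|` N) `|` (Y `\` K).
have BY : B `<=` Y by move=> x [[/AY//|/NY//]|[]].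
have [W [oW BW mW]] := radon_open_outer rm (finY BY) e2.
exists (W `|` ~` K), K; split => //.
  by apply: openU; [|exact: closed_openC].
split; first by move=> x ANx; left; apply: BW; left.
apply: (@le_trans _ _ (m W)).
  apply: le_outer_measure => x [[//|Kx] Yx].
  by apply: BW; right.
apply: (le_trans mW); rewrite [in leRHS](splitr e) EFinD addeA leeD2r//.
apply: (le_trans (outer_measureU2 _ _ _)); rewrite leeD//.
by apply: (le_trans (outer_measureU2 _ _ _)); rewrite mN adde0.
Qed.

(** A Vitali-Caratheodory theorem that also produces compact sublevel sets.  The
    values of F are rounded up to multiples of eta; the level set with value
    eta * (j + 1) is enlarged to an open set U j, and P is the supremum of the
    functions eta * (j + 1) on U j.  As all the U j contain the complement of Y
    and the points where F is infinite, P is infinite there. *)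
Lemma lsc_majorant (F : X -> \bar R) (c : R) :
  measurable_fun setT (F : T -> \bar R) -> (forall x, (0 <= F x)%E) ->
  (\int[mu]_(x in Y) F x < c%:E)%E ->
  exists (P : X -> \bar R) (eta : R), [/\ 0 < eta,
    (forall y, (eta%:E <= P y)%E),
    (forall y, Y y -> (F y <= P y)%E),
    (forall a : R, compact [set y | (P y <= a%:E)%E] /\
       [set y | (P y <= a%:E)%E] `<=` Y) &
    (\int[mu]_(x in Y) P x <= c%:E)%E].
Proof.
move=> mF F0 Fc.
have mF' : measurable_fun (Y : set T) (F : T -> \bar R) by exact: measurable_funTS.
have iF : (\int[mu]_(x in Y) F x)%E \is a fin_num.
  rewrite ge0_fin_numE ?(lt_trans Fc) ?ltry//.
  by apply: integral_ge0 => x _; exact: F0.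
pose d := (c - fine (\int[mu]_(x in Y) F x)%E) / 2.
have d0 : 0 < d by rewrite divr_gt0// subr_gt0 -lte_fin fineK.
pose r := fine (m Y).
have mYr : m Y = r%:E by rewrite /r fineK// ge0_fin_numE// outer_measure_ge0.
have r0 : 0 <= r by rewrite -lee_fin -mYr outer_measure_ge0.
pose eta := d / (r + 1).
have eta0 : 0 < eta by rewrite divr_gt0// ltr_wpDl.
have etar : eta * r <= d.
  by rewrite /eta mulrAC -mulrA ler_piMr ?(ltW d0)// ler_pdivrMr ?ltr_wpDl// mul1r lerDl.
pose lev (j : nat) : R := eta * j%:R.
pose A j : set X := Y `&` [set x | ((lev j)%:E <= F x < (lev j.+1)%:E)%E].
have AY j : A j `<=` Y by move=> x [].
have mA j : measurable (A j : set T).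
  have -> : A j = Y `&` [set x | ((lev j)%:E <= F x)%E] `&`
                  (Y `&` [set x | (F x < (lev j.+1)%:E)%E]).
    apply/seteqP; split=> x /=; first by case=> ? /andP[].
    by case=> [[? h1] [_ h2]]; split => //; apply/andP.
  apply: measurableI; first exact: (emeasurable_fun_c_infty mYm mF').
  exact: (emeasurable_fun_infty_o mYm mF').
pose N : set X := Y `&` [set x | F x = +oo%E].
have mN : m N = 0%E.
  have intF : mu.-integrable Y F.
    apply/integrableP; split => //.
    under eq_integral do rewrite gee0_abs ?F0//.
    by rewrite (lt_trans Fc)// ltry.
  have [B [mB B0 NB]] := integrable_ae mYm intF.
  apply/eqP; rewrite eq_le outer_measure_ge0 andbT -B0.
  apply: le_outer_measure => x [Yx Fx]; apply: NB => /= /(_ Yx).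
  by rewrite Fx.
have lev0 j : 0 < lev j.+1 by rewrite mulr_gt0.
(* The excess of m (U j) is weighted by the level, so that the total error is
   the sum of d / 2 ^ (j + 1). *)
have eps0 j : 0 < d / (2 ^ j.+1)%:R / lev j.+1.
  by apply: divr_gt0 => //; apply: divr_gt0 => //; rewrite ltr0n expn_gt0.
have /boolp.choice[U /boolp.choice[K UK]] j : exists U K,
    [/\ open U, compact K, K `<=` Y, ~` K `<=` U & A j `|` N `<=` U /\
      (m (U `&` Y) <= m (A j) + (d / (2 ^ j.+1)%:R / lev j.+1)%:E)%E].
  by apply: radon_open_cell => // x [].
pose P x := ereal_sup [set (lev j.+1)%:E | j in [set j | U j x]].
have PU j x : U j x -> ((lev j.+1)%:E <= P x)%E.
  by move=> Ujx; apply: ereal_sup_ubound; exists j.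
have covY x : Y x -> (exists2 j, A j x & U j x) \/ (F x = +oo%E /\ forall j, U j x).
  move=> Yx; have [Fx|] := eqVneq (F x) +oo%E.
    right; split => // j; have [_ _ _ _ [NU _]] := UK j.
    by apply: NU; right.
  move=> Fx; left; have Ffin : F x \is a fin_num by rewrite ge0_fin_numE// ltey.
  pose j := Num.truncn (fine (F x) / eta).
  have Fe0 : 0 <= fine (F x) / eta by rewrite divr_ge0 ?fine_ge0// ltW.
  have Ajx : A j x.
    split => //=; rewrite -(fineK Ffin) lee_fin lte_fin /lev !(mulrC eta).
    by rewrite -ler_pdivlMr// -ltr_pdivrMr// /j truncnS_gt truncn_le Fe0.
  exists j => //; have [_ _ _ _ [AU _]] := UK j; by apply: AU; left.
have covN x : ~ Y x -> forall j, U j x.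
  by move=> Yx j; have [_ _ KY KU _] := UK j; apply: KU => /KY.
have Pinf x : (forall j, U j x) -> P x = +oo%E.
  move=> Ux; apply/eqyP => a _.
  rewrite (le_trans _ (PU (Num.truncn (a / eta)) x (Ux _)))// lee_fin.
  by rewrite /lev mulrC -ler_pdivrMr// ltW// truncnS_gt.
have eta1 j : eta <= lev j.+1.
  by rewrite /lev ler_pMr// ler1n.
exists P, eta; split => //.
- move=> y; have [/covY[[j _ Ujy]|[_ /Pinf ->]]|/covN/Pinf ->] := pselect (Y y).
  + by rewrite (le_trans _ (PU _ _ Ujy))// lee_fin.
  + by rewrite leey.
  + by rewrite leey.
- move=> y /covY[[j [_ /andP[_ Fj]] Ujy]|[_ /Pinf ->]]; last by rewrite leey.
  by rewrite (le_trans (ltW Fj))// PU.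
- move=> a; pose j := Num.truncn (a / eta).
  have aj : a < lev j.+1 by rewrite /lev mulrC -ltr_pdivrMr// truncnS_gt.
  have [_ cK KY KU _] := UK j.
  have sub : [set y | (P y <= a%:E)%E] `<=` K j.
    move=> y /= Pa; apply: contrapT => /KU /PU /le_trans /(_ Pa).
    by rewrite lee_fin leNgt aj.
  split; last exact: subset_trans sub KY.
  apply: (subclosed_compact _ cK) => //.
  have -> : [set y | (P y <= a%:E)%E] =
      ~` (\bigcup_(i in [set i | a < lev i.+1]) U i).
    apply/seteqP; split => y /=.
      move=> Pa [i /= ai /PU] /le_trans /(_ Pa).
      by rewrite lee_fin leNgt ai.
    move=> nU; apply: ge_ereal_sup => _ [i /= Ui <-].
    by rewrite lee_fin leNgt; apply/negP => ai; apply: nU; exists i.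
  apply: open_closedC; apply: bigcup_open => i _.
  by have [] := UK i.
have mU j : measurable (U j : set T) by apply: open_cara => //; case: (UK j).
have mP : measurable_fun (Y : set T) (P : T -> \bar R).
  apply: measurable_funTS; apply: borel_cara => //; apply: lsc_borel => a.
  have -> : [set x | (a%:E < P x)%E] = \bigcup_(i in [set i | a < lev i.+1]) U i.
    apply/seteqP; split => y /=.
      by move=> /ereal_sup_gt[_ [i /= Ui <-]]; rewrite lte_fin => ai; exists i.
    by move=> [i /= ai /PU]; apply: lt_le_trans; rewrite lte_fin.
  by apply: bigcup_open => i _; have [] := UK i.
have P0 x : Y x -> (0 <= P x)%E.
  move=> /covY[[j _ Ujx]|[_ /Pinf ->]]; last by [].
  by rewrite (le_trans _ (PU _ _ Ujx))// lee_fin ltW.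
(* The supremum P is bounded by the sum of the functions t j. *)
pose t j x := ((lev j.+1)%:E * (\1_(U j) x)%:E)%E.
have t0 j x : (0 <= t j x)%E by rewrite mule_ge0// lee_fin ltW.
have mt j : measurable_fun (Y : set T) (t j : T -> \bar R).
  apply: emeasurable_funM => //; apply/measurable_EFinP.
  by apply: measurable_indic.
apply: (@le_trans _ _ (\int[mu]_(x in Y) (\sum_(0 <= j <oo) t j x))%E).
  apply: ge0_le_integral => //.
    by apply: ge0_emeasurable_sum => // j x _ _.
  move=> x Yx; apply: ge_ereal_sup => _ [j /= Ujx <-].
  apply: (@le_trans _ _ (\sum_(0 <= i < j.+1) t i x)%E); last first.
    by apply: nneseries_lim_ge => i _ _.
  rewrite big_nat_recr//= [X in (_ <= _ + X)%E]/t indicE mem_set// mule1.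
  by rewrite leeDr// sume_ge0.
rewrite integral_nneseries//.
apply: (@le_trans _ _ (\sum_(0 <= j <oo)
    ((lev j.+1)%:E * m (A j) + (d / (2 ^ j.+1)%:R)%:E))%E).
  apply: lee_nneseries => [i _ _|i _].
    by apply: integral_ge0 => x _.
  rewrite /t ge0_integralZl//=; last 2 first.
    by apply/measurable_EFinP; exact: measurable_indic.
    by rewrite lee_fin ltW.
  rewrite integral_indic//.
  have [_ _ _ _ [_ mUi]] := UK i.
  apply: (@le_trans _ _ ((lev i.+1)%:E *
     (m (A i) + (d / (2 ^ i.+1)%:R / lev i.+1)%:E))%E).
    by apply: lee_wpmul2l; [rewrite lee_fin ltW|exact: mUi].
  rewrite ge0_muleDr ?outer_measure_ge0//; last first.
    by rewrite lee_fin ltW.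
  by rewrite leeD2l// -EFinM lee_fin mulrC divfK// gt_eqF.
have s0 i : (0 <= (lev i.+1)%:E * m (A i))%E.
  by rewrite mule_ge0 ?outer_measure_ge0// lee_fin ltW.
apply: (le_trans (epsilon_trick xpredT s0 (ltW d0))).
apply: (@le_trans _ _ (\int[mu]_(x in Y) (F x + eta%:E) + d%:E)%E); last first.
  rewrite ge0_integralD//; last by move=> x _; rewrite lee_fin ltW.
  rewrite integral_cst// -(fineK iF).
  have -> : mu Y = r%:E by exact: mYr.
  rewrite -EFinM -!EFinD lee_fin.
  have : c = fine (\int[mu]_(x in Y) F x) + d + d by rewrite /d; lra.
  by move=> ->; rewrite lerD// lerD.
rewrite leeD2r//.
have mFe : measurable_fun (Y : set T) (fun x : T => F x + eta%:E)%E by exact: emeasurable_funD.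
have Fe0 x : (0 <= F x + eta%:E)%E by rewrite adde_ge0// lee_fin ltW.
apply: (@le_trans _ _ (\int[mu]_(x in \bigcup_j A j) (F x + eta%:E))%E); last first.
  apply: ge0_subset_integral => //; first exact: bigcup_measurable.
  by move=> x [j _ []].
rewrite ge0_integral_bigcup//; first last.
- apply/trivIsetP => i j _ _; wlog ij : i j / (i < j)%N.
    by move=> W; rewrite neq_ltn => /orP[ij|ji]; [|rewrite setIC]; apply: W; rewrite ?ltn_eqF// gtn_eqF.
  move=> _; apply/seteqP; split => // x [[_ /andP[_ Fi]] [_ /andP[jF _]]].
  have ij1 : ((lev i.+1)%:E <= (lev j)%:E)%E.
    by rewrite lee_fin /lev ler_pM2l// ler_nat.
  by have := lt_le_trans Fi (le_trans ij1 jF); rewrite ltxx.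
- apply: (measurable_funS _ _ mFe) => // x [j _ []] //.
apply: lee_nneseries => // i _.
rewrite -(integral_cst mu (mA i)).
apply: ge0_le_integral => //; first by move=> x _; rewrite lee_fin ltW.
  by apply: (measurable_funS _ _ mFe) => // x [].
move=> x [_ /andP[Fi _]]; rewrite /lev -natr1 mulrDr mulr1 EFinD leeD2r//.
Qed.

End majorant.

(** * Norms, truncations and cutoffs of real numbers *)

Lemma ge0_le_poweR (R : realType) (r : R) (a b : \bar R) :
  0 <= r -> (0 <= a)%E -> (a <= b)%E -> (a `^ r <= b `^ r)%E.
Proof.
move=> r0 a0 ab; apply: gt0_ler_poweR => //; rewrite in_itv/= ?leey ?andbT//.
exact: le_trans ab.
Qed.

Section Lnorm_complements.
Context d {T : measurableType d} {R : realType}.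
Variables (mu : {measure set T -> \bar R}) (p : R).
Hypothesis p0 : 0 < p.
Local Notation "'N[ f ]" := (Lnorm mu p%:E f) (format "''N[' f ]").

Lemma le_Lnorm (f g : T -> \bar R) : measurable_fun setT f ->
  measurable_fun setT g -> (forall x, (`|f x| <= `|g x|)%E) -> ('N[f] <= 'N[g])%E.
Proof.
move=> mf mg fg; rewrite unlock /Lnorm.
have m h : measurable_fun setT h -> measurable_fun setT (fun x : T => `|h x| `^ p)%E.
  move=> mh; apply: (measurableT_comp (measurable_poweR _)).
  exact: measurableT_comp.
apply: ge0_le_poweR; first by rewrite invr_ge0 ltW.
  by apply: integral_ge0 => x _; exact: poweR_ge0.
apply: ge0_le_integral => //; [|exact: m|exact: m|].
  by move=> x _; exact: poweR_ge0.
by move=> x _; apply: ge0_le_poweR => //; exact: ltW.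
Qed.

Lemma Lnorm_leP (f : T -> \bar R) (c : R) : 0 <= c ->
  ('N[f] <= c%:E)%E <-> (\int[mu]_x (`|f x| `^ p) <= (c `^ p)%:E)%E.
Proof.
move=> c0; rewrite -poweR_EFin -poweR_Lnorm ?gt_eqF//; split.
  by move=> fc; rewrite ge0_le_poweR ?(ltW p0) ?Lnorm_ge0.
have p1 : 0 <= p^-1 by rewrite invr_ge0 ltW.
move=> /(ge0_le_poweR p1 (poweR_ge0 _ _)); rewrite -!poweRrM mulfV ?gt_eqF//.
by rewrite !poweRe1// Lnorm_ge0.
Qed.

Lemma Lnorm_ltP (f : T -> \bar R) (c : R) : 0 <= c ->
  ('N[f] < c%:E)%E <-> (\int[mu]_x (`|f x| `^ p) < (c `^ p)%:E)%E.
Proof.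
move=> c0; rewrite -poweR_EFin -poweR_Lnorm ?gt_eqF//; split.
  move=> fc; rewrite lt_neqAle ge0_le_poweR ?(ltW p0) ?(ltW fc) ?Lnorm_ge0// andbT.
  apply/eqP => /(congr1 (fun z => z `^ p^-1)%E).
  rewrite -!poweRrM mulfV ?gt_eqF// !poweRe1 ?Lnorm_ge0// => fc'.
  by rewrite fc' ltxx in fc.
move=> fc; rewrite ltNge; apply/negP => cf.
by move: fc; rewrite ltNge ge0_le_poweR ?(ltW p0).
Qed.

Lemma LnormMl (f : T -> R) (c : R) : measurable_fun setT f -> 0 <= c ->
  'N[EFin \o (fun x => c * f x)] = (c%:E * 'N[EFin \o f])%E.
Proof.
move=> mf c0; rewrite unlock /Lnorm.
under eq_integral => x _.
  rewrite /= normrM (ger0_norm c0) powRM// EFinM; over.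
rewrite ge0_integralZl//=.
- rewrite poweRM ?lee_fin ?powR_ge0//.
    by rewrite poweR_EFin -powRrM mulfV ?gt_eqF// powRr1.
  by apply: integral_ge0 => x _; rewrite lee_fin powR_ge0.
- apply/measurable_EFinP; apply: (measurableT_comp (measurable_powR _)).
  exact: measurableT_comp.
- by rewrite lee_fin powR_ge0.
Qed.

End Lnorm_complements.

Section cutoffs.
Context {R : realType}.
Implicit Types (a b k : R).

Definition clamp01 a := Num.max 0 (Num.min 1 a).
Definition truncr k a := Num.max (- k) (Num.min k a).

Lemma clamp01_ge0 a : 0 <= clamp01 a.
Proof. by rewrite /clamp01 le_max lexx. Qed.

Lemma clamp01_le1 a : clamp01 a <= 1.
Proof. by rewrite /clamp01 ge_max ler01 ge_min lexx. Qed.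

Lemma clamp01_1 a : 1 <= a -> clamp01 a = 1.
Proof. by move=> a1; rewrite /clamp01 min_l// max_r. Qed.

Lemma clamp01_0 a : a <= 0 -> clamp01 a = 0.
Proof. by move=> a0; rewrite /clamp01 min_r ?(le_trans a0)// max_l. Qed.

Lemma clamp01_lip a b : `|clamp01 a - clamp01 b| <= `|a - b|.
Proof.
have := ler_norm (a - b); have := ler_norm (- (a - b)); rewrite normrN ler_norml.
rewrite /clamp01 /Num.max /Num.min; repeat case: ifPn; rewrite -?leNgt; lra.
Qed.

Lemma truncr_lip k a b : 0 <= k -> `|truncr k a - truncr k b| <= `|a - b|.
Proof.
move=> k0; have := ler_norm (a - b); have := ler_norm (- (a - b)); rewrite normrN ler_norml.
rewrite /truncr /Num.max /Num.min; repeat case: ifPn; rewrite -?leNgt; lra.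
Qed.

Lemma truncr_le k a : 0 <= k -> `|truncr k a| <= k.
Proof.
move=> k0; rewrite ler_norml.
rewrite /truncr /Num.max /Num.min; repeat case: ifPn; rewrite -?leNgt; lra.
Qed.

Lemma truncr_norm k a : 0 <= k -> `|truncr k a| <= `|a|.
Proof.
move=> k0; have := ler_norm a; have := ler_norm (- a); rewrite normrN ler_norml.
rewrite /truncr /Num.max /Num.min; repeat case: ifPn; rewrite -?leNgt; lra.
Qed.

Lemma truncr_id k a : `|a| <= k -> truncr k a = a.
Proof. by rewrite ler_norml => /andP[? ?]; rewrite /truncr min_r// max_r. Qed.

Lemma cut_trunc_dist c k a : 0 <= c <= 1 -> 0 <= k ->
  `|c * truncr k a - a| <= `|a|.
Proof.
move=> /andP[c0 c1] k0; have := ler_norm a; have := ler_norm (- a).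
rewrite normrN ler_norml => aN aP.
have [a0|a0] := lerP 0 a.
  have /andP[t0 ta] : 0 <= truncr k a <= a.
    by rewrite /truncr /Num.max /Num.min; repeat case: ifPn; rewrite -?leNgt; lra.
  have : c * truncr k a <= a by rewrite (le_trans _ ta)// ler_piMl.
  have : 0 <= c * truncr k a by rewrite mulr_ge0.
  by lra.
have /andP[t0 ta] : a <= truncr k a <= 0.
  by rewrite /truncr /Num.max /Num.min; repeat case: ifPn; rewrite -?leNgt; lra.
have : a <= c * truncr k a by rewrite (le_trans t0)// ler_niMl.
have : c * truncr k a <= 0 by rewrite mulr_ge0_le0.
by lra.
Qed.

(** The form of the product rule that respects the mean of the gradient over the
    two ends of a step. *)
Lemma dist_mul_avg c1 c2 a b : 0 <= c1 -> 0 <= c2 ->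
  `|c1 * a - c2 * b| <=
  (c1 + c2) / 2 * `|a - b| + (`|a| + `|b|) / 2 * `|c1 - c2|.
Proof.
move=> c10 c20.
have -> : c1 * a - c2 * b = (c1 + c2) / 2 * (a - b) + (a + b) / 2 * (c1 - c2).
  by field.
rewrite (le_trans (ler_normD _ _))// !normrM.
rewrite (ger0_norm (_ : 0 <= c1 + c2)) ?addr_ge0// (ger0_norm (_ : 0 <= 2^-1))//.
by rewrite lerD2l ler_wpM2r// ler_wpM2r// ler_normD.
Qed.

(** The product rule with all the weight on one end, suited to slopes. *)
Lemma dist_mul_side c1 c2 a b : 0 <= c2 <= 1 ->
  `|c1 * a - c2 * b| <= `|a - b| + `|a| * `|c1 - c2|.
Proof.
move=> /andP[c20 c21].
have -> : c1 * a - c2 * b = c2 * (a - b) + a * (c1 - c2) by ring.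
rewrite (le_trans (ler_normD _ _))// !normrM lerD2r.
by rewrite (ger0_norm c20) ler_piMl.
Qed.

Lemma near_or_far a b k : `|a - b| <= 1 ->
  (a <= k + 1) && (b <= k + 1) \/ (k <= a) && (k <= b).
Proof.
rewrite ler_norml => /andP[? ?].
have [ak|ak] := lerP a (k + 1); have [bk|bk] := lerP b (k + 1);
  [by left|right|right|right]; by apply/andP; split; lra.
Qed.

End cutoffs.

(** * Lipschitz functions *)

Section lipschitz_functions.
Context {R : realType} {X : metricPType R}.
Implicit Types (f g u w : X -> R) (x y z : X) (k : R).

Lemma mdist_lip z x y : `|mdist z x - mdist z y| <= mdist x y.
Proof.
have := metric_triangle z x y; have := metric_triangle z y x.
by rewrite (metric_sym y) ler_norml; lra.
Qed.

Lemma Lip_ge0P u : Lip u -> exists2 L, 0 <= L & forall x y, `|u x - u y| <= L * mdist x y.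
Proof.
move=> [L uL]; exists `|L| => // x y; rewrite (le_trans (uL x y))//.
by rewrite ler_wpM2r ?mdist_ge0// ler_norm.
Qed.

Lemma LipD f g : Lip f -> Lip g -> Lip (fun x => f x + g x).
Proof.
move=> [A fA] [B gB]; exists (A + B) => x y; rewrite mulrDl.
have -> : f x + g x - (f y + g y) = (f x - f y) + (g x - g y) by ring.
by rewrite (le_trans (ler_normD _ _))// lerD.
Qed.

Lemma Lip_mul_bounded f g (A B : R) : Lip f -> Lip g ->
  (forall x, `|f x| <= A) -> (forall x, `|g x| <= B) -> Lip (fun x => f x * g x).
Proof.
move=> /Lip_ge0P[K K0 fK] /Lip_ge0P[L L0 gL] fA gB.
exists (A * L + K * B) => x y.
have -> : f x * g x - f y * g y = f x * (g x - g y) + (f x - f y) * g y by ring.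
rewrite (le_trans (ler_normD _ _))// !normrM mulrDl -mulrA lerD//.
  by rewrite ler_pM.
by rewrite mulrAC ler_pM.
Qed.

Lemma Lip_div_norm f k : 0 < k -> Lip f -> Lip (fun x => `|f x| / k).
Proof.
move=> k0 [A fA]; exists (A / k) => x y.
rewrite -mulrBl normrM (gtr0_norm (_ : 0 < k^-1)) ?invr_gt0// mulrAC.
by rewrite ler_pM2r ?invr_gt0// (le_trans (ler_dist_dist _ _)).
Qed.

(** A bounded function that is Lipschitz at small scale is Lipschitz: at larger
    distances its oscillation is at most twice its bound. *)
Lemma Lip_local_bounded (w : X -> R) (A M r : R) : 0 < r -> 0 <= A ->
  (forall x, `|w x| <= M) ->
  (forall x y, mdist x y <= r -> `|w x - w y| <= A * mdist x y) -> Lip w.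
Proof.
move=> r0 A0 wM wA; exists (A + 2 * M / r) => x y.
have M0 : 0 <= M by exact: le_trans (wM x).
have d0 := mdist_ge0 x y; have [xy|xy] := leP (mdist x y) r.
  by rewrite (le_trans (wA x y xy))// ler_wpM2r// lerDl divr_ge0 ?mulr_ge0// ltW.
rewrite (le_trans (ler_normB _ _))// (le_trans (lerD (wM x) (wM y)))//.
rewrite mulrDl ler_wpDl ?mulr_ge0// mulrAC ler_pdivlMr//.
have -> : M + M = 2 * M by ring.
by rewrite ler_wpM2l ?mulr_ge0// ltW.
Qed.

End lipschitz_functions.

(** * Chain upper gradients and the functionals *)

Section gradients.
Context {R : realType} {X : metricPType R}.
Implicit Types (u : X -> R) (g : X -> \bar R) (eps : R).

Lemma chain_integral_cons g q y s : chain_integral g q (y :: s) =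
  ((g q + g y) * (2^-1)%:E * (mdist q y)%:E + chain_integral g y s)%E.
Proof.
rewrite /chain_integral big_ord_recl/=; congr (_ + _)%E.
apply: eq_bigr => i _.
have e1 : nth q s i = nth y s i by exact: set_nth_default.
have e0 : nth q (y :: s) i = nth y (y :: s) i.
  by apply: set_nth_default; rewrite ltnS ltnW.
by rewrite /= e0 e1.
Qed.

Lemma UG_pair eps u g x y : UG eps u g -> mdist x y <= eps ->
  (`|u x - u y|%:E <= (g x + g y) * (2^-1)%:E * (mdist x y)%:E)%E.
Proof.
move=> [_ _ /(_ x [:: y])] + xy; rewrite /eps_chain/= xy distrC => /(_ isT).
by rewrite chain_integral_cons /chain_integral big_ord0 adde0.
Qed.

(** A chain upper gradient is determined by chains of two points, because both
    sides of the defining inequality are compatible with concatenation. *)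
Lemma pair_UG eps u g : borel g -> (forall x, (0 <= g x)%E) ->
  (forall x y, mdist x y <= eps ->
    (`|u x - u y|%:E <= (g x + g y) * (2^-1)%:E * (mdist x y)%:E)%E) ->
  UG eps u g.
Proof.
move=> bg g0 H; split => // q s; elim: s q => [|y s IH] q.
  by rewrite /= subrr normr0 /chain_integral big_ord0.
rewrite /eps_chain/= => /andP[qy ys]; rewrite chain_integral_cons.
apply: (@le_trans _ _ (`|u q - u y|%:E + `|u (last y s) - u y|%:E)%E).
  rewrite -EFinD lee_fin (distrC (u q)) [leRHS]addrC.
  exact: ler_distD.
by apply: leeD; [exact: H|exact: IH].
Qed.

Lemma Lip_borel u : Lip u -> borel (EFin \o u).
Proof.
move=> [L uL]; apply: lsc_borel => a; rewrite openE => x /=; rewrite lte_fin => ax.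
apply/metricType_numDomainType.nbhs_mdistP.
have L1 : 0 < `|L| + 1 by rewrite ltr_wpDl.
exists ((u x - a) / (`|L| + 1)) => /=; first by rewrite divr_gt0// subr_gt0.
move=> y /=; rewrite ltr_pdivlMr// lte_fin => xy.
have := uL x y; have := ler_norm (u x - u y); have := mdist_ge0 x y.
have := ler_norm L; nra.
Qed.

(** All the limits as eps tends to 0 in the definitions are of monotone functions,
    hence infima. *)
Lemma lim_at0_nondecreasing (f : R -> \bar R) :
  (forall a b, 0 < a -> a <= b -> (f a <= f b)%E) ->
  f e @[e --> 0^'+] --> ereal_inf (f @` [set e | 0 < e]).
Proof.
move=> fm; have -> : [set e | 0 < e] = [set` `]0, +oo[] :> set R.
  by apply/seteqP; split => e /=; rewrite in_itv/= andbT.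
apply: (@nondecreasing_at_right_cvge R f 0 (BInfty _ false)) => // a b.
by rewrite !in_itv/= !andbT => a0 _; exact: fm.
Qed.

Lemma UG_antimono eps1 eps2 u : eps1 <= eps2 -> UG eps2 u `<=` UG eps1 u.
Proof.
move=> e12 g [bg g0 ug]; split => // q s cs; apply: ug.
by apply: sub_path cs => x y /= /le_trans; exact.
Qed.

Lemma LUG_antimono eps1 eps2 u : eps1 <= eps2 -> LUG eps2 u `<=` LUG eps1 u.
Proof. by move=> e12 g [/(UG_antimono e12)]. Qed.

End gradients.

Section functionals.
Context {R : realType} {X : metricPType R}.
Variables (m : {outer_measure set X -> \bar R}) (p : R) (p1 : (1 <= p%:E)%E).
Hypothesis rm : radon m.
Local Notation T := (caratheodory_type m).
Local Notation mu := (cara_measure m).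
Implicit Types (u v w : Lfun_space m p1).

Lemma Lfun_measurable v : measurable_fun setT (v : T -> R).
Proof. exact: measurable_funP. Qed.

Lemma Lfun_norm_fin v : (Lp_norm m p (EFin \o v) < +oo)%E.
Proof. exact: Lfunction_finite. Qed.

Lemma Lfun_of (f : X -> R) : measurable_fun setT (f : T -> R) ->
  (Lp_norm m p (EFin \o f) < +oo)%E -> exists v : Lfun_space m p1, f = v.
Proof.
move=> mf nf; have Pf : (f : T -> R) \in Lfun mu p%:E by apply/andP; rewrite !inE.
by exists (Lfun_Sub p1 Pf).
Qed.

Lemma Lip_measurable (f : X -> R) : Lip f -> measurable_fun setT (f : T -> R).
Proof.
by move=> /Lip_borel /(borel_cara rm) ?; exact/measurable_EFinP.
Qed.

Lemma Lp_norm_triangle (f g h : X -> R) :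
  measurable_fun setT (f : T -> R) -> measurable_fun setT (g : T -> R) ->
  measurable_fun setT (h : T -> R) ->
  (Lp_norm m p (fun x => (f x - h x)%:E) <=
   Lp_norm m p (fun x => (f x - g x)%:E) + Lp_norm m p (fun x => (g x - h x)%:E))%E.
Proof.
move=> mf mg mh.
have := @eminkowski _ T _ mu (f \- g)%R (g \- h)%R p%:E (measurable_funB mf mg) (measurable_funB mg mh) p1.
apply: le_trans; rewrite /Lp_norm le_eqVlt; apply/orP; left; apply/eqP.
by apply: eq_Lnorm => x /=; rewrite addrA subrK.
Qed.

(** There are fewer chains for smaller eps, hence more upper gradients. *)
Let FC_inf (U : R -> set (X -> \bar R)) :
  (forall a b, a <= b -> U b `<=` U a) ->
  lim (ereal_inf [set Lp_norm m p g | g in U eps] @[eps --> (0 : R)^'+]) =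
  ereal_inf [set ereal_inf [set Lp_norm m p g | g in U eps] | eps in [set eps | 0 < eps]].
Proof.
move=> Um; apply/cvg_lim => //; apply: lim_at0_nondecreasing => a b a0 ab.
apply: ereal_inf_le_tmp => _ [g Ug <-]; exists g => //.
exact: Um ab _ Ug.
Qed.

Lemma F_C_le v eps g : 0 < eps -> UG eps v g -> (F_C m p1 v <= Lp_norm m p g)%E.
Proof.
move=> e0 ug; rewrite /F_C FC_inf; last by move=> a b; exact: UG_antimono.
apply: (@le_trans _ _ (ereal_inf [set Lp_norm m p g | g in UG eps v])).
  by apply: ereal_inf_lbound; exists eps.
by apply: ereal_inf_lbound; exists g.
Qed.

Lemma F_C_lt v c : (F_C m p1 v < c)%E ->
  exists eps g, [/\ 0 < eps, UG eps v g & (Lp_norm m p g < c)%E].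
Proof.
rewrite /F_C FC_inf; last by move=> a b; exact: UG_antimono.
move=> /ereal_inf_lt[_ [eps /= e0 <-]].
by move=> /ereal_inf_lt[_ [g ug <-] gc]; exists eps, g.
Qed.

Lemma F_CLip_le v eps g : Lip v -> 0 < eps -> LUG eps v g ->
  (F_CLip m p1 v <= Lp_norm m p g)%E.
Proof.
move=> lv e0 ug; rewrite /F_CLip; case: asboolP => // _.
rewrite FC_inf; last by move=> a b; exact: LUG_antimono.
apply: (@le_trans _ _ (ereal_inf [set Lp_norm m p g | g in LUG eps v])).
  by apply: ereal_inf_lbound; exists eps.
by apply: ereal_inf_lbound; exists g.
Qed.

Lemma F_CLip_ge v c :
  (Lip v -> forall eps g, 0 < eps -> LUG eps v g -> (c <= Lp_norm m p g)%E) ->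
  (c <= F_CLip m p1 v)%E.
Proof.
move=> H; rewrite /F_CLip; case: asboolP => [lv|_]; last by rewrite leey.
rewrite FC_inf; last by move=> a b; exact: LUG_antimono.
apply: le_ereal_inf_tmp => _ [eps /= e0 <-].
by apply: le_ereal_inf_tmp => _ [g ug <-]; exact: (H lv eps g e0 ug).
Qed.

(** The inferior limit sees only the infima of tails, on which 1/(n+1) is below any
    given e. *)
Lemma limn_einf_le_approx (a b : nat -> \bar R) :
  (forall n, (a n <= b n + (n.+1%:R^-1)%:E)%E) -> (limn_einf a <= limn_einf b)%E.
Proof.
move=> ab; apply/lee_addgt0Pr => e e0.
rewrite [leLHS]limf_einfE; apply: ge_ereal_sup => _ [V /= Voo <-].
rewrite -leeBlDr//.
pose W := V `&` [set n | n.+1%:R^-1 < e].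
apply: (@le_trans _ _ (ereal_inf (b @` W))); last first.
  rewrite [leRHS]limf_einfE; apply: ereal_sup_ubound; exists W => //.
  by apply: filterI => //; exact: near_infty_natSinv_lt (PosNum e0).
apply: le_ereal_inf_tmp => _ [n [Vn ne] <-]; rewrite leeBlDr//.
apply: (@le_trans _ _ (a n)); first by apply: ereal_inf_lbound; exists n.
by rewrite (le_trans (ab n))// leeD2l// lee_fin ltW.
Qed.

(** A recovery sequence for G is moved term by term to one for F. *)
Lemma relaxation_le (F G : Lfun_space m p1 -> \bar R) :
  (forall v (d : R), 0 < d -> exists w,
    (Lp_norm m p (fun x => (w x - v x)%:E) <= d%:E)%E /\ (F w <= G v + d%:E)%E) ->
  forall u : Lp_space m p1, (relaxation F u <= relaxation G u)%E.
Proof.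
move=> H u; apply: le_ereal_inf_tmp => _ [v /= vu <-].
have /boolp.choice[w Hw] n : exists w,
    (Lp_norm m p (fun x => (w x - v n x)%:E) <= (n.+1%:R^-1)%:E)%E /\
    (F w <= G (v n) + (n.+1%:R^-1)%:E)%E by apply: H; rewrite invr_gt0.
apply: (@le_trans _ _ (limn_einf (fun j => F (w j)))); last first.
  by apply: limn_einf_le_approx => n; have [] := Hw n.
apply: ereal_inf_lbound; exists w => //=.
apply: (@squeeze_cvge _ _ _ _ (cst 0%E) _ (fun j =>
   ((j.+1%:R^-1)%:E + Lp_norm m p (fun x => (v j x - u x)%:E))%E)).
- apply: nearW => j; rewrite Lnorm_ge0/=.
  apply: (le_trans (Lp_norm_triangle (Lfun_measurable _) (Lfun_measurable (v j)) _)).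
    exact: (@measurable_funP _ _ _ _ _ (repr (LebesgueSpace.sort u))).
  by rewrite leeD2r//; have [] := Hw j.
- exact: cvg_cst.
- rewrite -[X in _ --> X](adde0 0%E); apply: cvgeD => //.
  by apply/cvg_EFin; [exact: nearW|exact: cvg_harmonic].
Qed.

End functionals.

(** * Norms on a set of finite measure *)

Section restricted_norms.
Context d {T : measurableType d} {R : realType}.
Variables (mu : {measure set T -> \bar R}) (p : R) (B : set T).
Hypotheses (p1 : 1 <= p) (mB : measurable B).
Local Notation "'N[ f ]" := (Lnorm mu p%:E (EFin \o f)) (format "''N[' f ]").

Let p0 : 0 < p. Proof. exact: lt_le_trans p1. Qed.

Lemma Lnorm_indic_le (f : T -> R) (c : R) : 0 <= c ->
  (\int[mu]_(x in B) (`|f x| `^ p)%:E <= (c `^ p)%:E)%E ->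
  ('N[(fun x => \1_B x * f x)%R] <= c%:E)%E.
Proof.
move=> c0 fc; apply/(Lnorm_leP _ p0); first exact: c0.
apply: le_trans fc.
rewrite [in leRHS]integral_mkcond le_eqVlt; apply/orP; left; apply/eqP.
apply: eq_integral => x _; rewrite /= patchE indicE.
by case: ifP => _; rewrite ?mul1r// mul0r normr0 powR0// gt_eqF.
Qed.

(** Among functions with a common bound L, smallness in L^1 gives smallness in L^p,
    as |f| ^ p <= L ^ (p - 1) |f|. *)
Lemma Lnorm_indic_bounded (f : T -> R) (L a e : R) : measurable_fun setT f ->
  0 <= e -> (forall x, B x -> `|f x| <= L) ->
  (\int[mu]_(x in B) `|f x|%:E <= a%:E)%E -> L `^ (p - 1) * a <= e `^ p ->
  ('N[(fun x => \1_B x * f x)%R] <= e%:E)%E.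
Proof.
move=> mf e0 fL fa La; apply: Lnorm_indic_le => //.
have mf' : measurable_fun B (fun x => `|f x|).
  by apply: measurable_funTS; exact: measurableT_comp.
have mA : measurable_fun B (fun x => (`|f x| `^ p)%:E).
  by apply/measurable_EFinP; apply: (measurableT_comp (measurable_powR _)).
have mC : measurable_fun B (fun x => (L `^ (p - 1))%:E * `|f x|%:E)%E.
  by apply: emeasurable_funM => //; exact/measurable_EFinP.
apply: (@le_trans _ _ (\int[mu]_(x in B) ((L `^ (p - 1))%:E * `|f x|%:E))%E).
  apply: ge0_le_integral => // x Bx.
  rewrite -EFinM lee_fin -(mulr_powRB1 _ p0)// mulrC.
  rewrite ler_wpM2r// ge0_ler_powR ?subr_ge0 ?nnegrE ?fL//.
  by rewrite (le_trans _ (fL _ Bx)).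
rewrite ge0_integralZl//; last by rewrite lee_fin powR_ge0.
  by rewrite (le_trans (lee_wpmul2l _ fa)) ?lee_fin ?powR_ge0//.
exact/measurable_EFinP.
Qed.

Lemma Lnorm_indic_cvg0 (f : nat -> T -> R) (L e : R) :
  (mu B < +oo)%E -> 0 < e -> (forall n, measurable_fun setT (f n)) ->
  (forall n x, B x -> `|f n x| <= L) ->
  (forall x, B x -> f n x @[n --> \oo] --> 0) ->
  \forall n \near \oo, ('N[(fun x => \1_B x * f n x)%R] <= e%:E)%E.
Proof.
move=> Boo e0 mf fL f0.
have fL' n x : B x -> `|f n x| <= `|L| by move=> /(fL n) /le_trans; apply; exact: ler_norm.
have mf' n : measurable_fun B (fun x => `|f n x|).
  by apply: measurable_funTS; exact: measurableT_comp.
have iL : mu.-integrable B (cst `|L|%:E).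
  apply/integrableP; split; first exact: measurable_cst.
  under eq_integral do rewrite /= normr_id.
  rewrite integral_cst// lte_mul_pinfty// ?lee_fin//.
have fcv x : B x -> `|f n x|%:E @[n --> \oo] --> 0%E.
  move=> /f0 fx; apply: cvg_EFin; first exact: nearW.
  by rewrite -(@normr0 _ R); exact: cvg_norm.
have mfE n : measurable_fun B (fun x => `|f n x|%:E) by exact/measurable_EFinP.
have dom x n : B x -> (`| `|f n x|%:E | <= cst `|L|%:E x)%E.
  by move=> Bx; rewrite /= normr_id lee_fin fL'.
have [_ _] := dominated_convergence mB mfE (measurable_cst 0%E)
  (aeW mu fcv) iL (aeW mu dom).
rewrite integral0 => cv.
pose a := e `^ p / (`|L| `^ (p - 1) + 1).
have a0 : 0 < a by rewrite divr_gt0 ?powR_gt0// ltr_wpDl// powR_ge0.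
have : \forall n \near \oo, (\int[mu]_(x in B) `|f n x|%:E <= a%:E)%E.
  have a0' : (0%E < a%:E)%E by rewrite lte_fin.
  have cva : \forall n \near \oo, (\int[mu]_(x in B) `|f n x|%:E < a%:E)%E.
    exact: (cv _ (open_ereal_lt' a0')).
  by apply: filterS cva => n /ltW.
apply: filterS => n fa; apply: (@Lnorm_indic_bounded _ `|L| a) => //.
- exact: ltW.
- by move=> x; exact: fL'.
- rewrite /a mulrCA ler_piMr ?powR_ge0// ler_pdivrMr ?mul1r ?lerDl//.
Qed.

End restricted_norms.

(** * Slopes and the local Lipschitz constant *)

Section slopes.
Context {R : realType} {X : metricPType R}.
Implicit Types (u : X -> R) (e L : R).

(** The maximum with 0 gives the value 0, instead of the supremum -oo of the empty
    set, at points that have no other point of X within distance e. *)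
Definition slope u e x : \bar R := maxe 0%E
  (ereal_sup [set (`|u y - u x| / mdist x y)%:E | y in ball x e `\ x]).

Lemma slope_ge0 u e x : (0 <= slope u e x)%E.
Proof. by rewrite /slope le_max lexx. Qed.

Lemma slope_leP u e x (c : R) : 0 <= c ->
  (forall y, mdist x y < e -> `|u y - u x| <= c * mdist x y) ->
  (slope u e x <= c%:E)%E.
Proof.
move=> c0 H; rewrite /slope ge_max lee_fin c0/=.
apply: ge_ereal_sup => _ [y /= [xy yx] <-].
have d0 : 0 < mdist x y by rewrite mdist_gt0; apply/eqP => /esym.
by rewrite lee_fin ler_pdivrMr// H//; move: xy; rewrite ballEmdist.
Qed.

Lemma slope_ge u e x y : mdist x y < e ->
  (`|u y - u x|%:E <= slope u e x * (mdist x y)%:E)%E.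
Proof.
move=> xy; have [->|yx] := eqVneq y x; first by rewrite subrr normr0 mdistxx mule0.
have d0 : 0 < mdist x y by rewrite mdist_gt0 eq_sym.
have -> : `|u y - u x| = `|u y - u x| / mdist x y * mdist x y.
  by rewrite divfK// gt_eqF.
rewrite EFinM lee_wpmul2r ?lee_fin ?(ltW d0)//.
rewrite /slope le_max; apply/orP; right.
by apply: ereal_sup_ubound; exists y => //; rewrite ballEmdist; split => //; exact/eqP.
Qed.

Lemma slope_mono u x e1 e2 : e1 <= e2 -> (slope u e1 x <= slope u e2 x)%E.
Proof.
move=> e12; rewrite /slope ge_max le_max lexx/= le_max; apply/orP; right.
apply: ge_ereal_sup => _ [y [xy yx] <-]; apply: ereal_sup_ubound.
exists y => //; split => //.
by move: xy; rewrite !ballEmdist /= => /lt_le_trans; exact.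
Qed.

Lemma slope_cvg u x :
  slope u e x @[e --> 0^'+] --> ereal_inf ((slope u ^~ x) @` [set e | 0 < e]).
Proof. by apply: lim_at0_nondecreasing => a b a0 ab; exact: slope_mono. Qed.

Lemma lipE u x : lip u x = ereal_inf ((slope u ^~ x) @` [set e | 0 < e]).
Proof.
rewrite /lip; case: asboolP => [[_ [V /nbhs_ballP[e /= e0 eV]] Vx]|iso].
  apply/eqP; rewrite eq_le; apply/andP; split.
    by apply: le_ereal_inf_tmp => _ [r _ <-]; exact: slope_ge0.
  apply: (@le_trans _ _ (slope u e x)).
    by apply: ereal_inf_lbound; exists e.
  apply: slope_leP => // y xy; have : (V `&` [set: X]) y.
    by split => //; apply: eV; rewrite ballEmdist.
  by rewrite Vx => ->; rewrite subrr normr0 mul0r.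
apply: cvg_lim => //; apply: (cvg_trans _ (@slope_cvg u x)).
apply: near_eq_cvg; near=> e.
have e0 : 0 < e by near: e; exact: nbhs_right_gt.
have [y [xy yx]] : exists y, ball x e y /\ y <> x.
  apply: contrapT => nY; apply: iso; split; first by rewrite inE.
  exists (ball x e); first exact: nbhsx_ballx.
  apply/seteqP; split => y /=.
    by move=> [xy _]; apply: contrapT => yx; apply: nY; exists y.
  by move=> ->; split => //; exact: ballxx.
rewrite /slope max_r//; apply: (@le_trans _ _ (`|u y - u x| / mdist x y)%:E).
  by rewrite lee_fin divr_ge0// mdist_ge0.
by apply: ereal_sup_ubound; exists y.
Unshelve. all: by end_near. Qed.

Lemma lip_ge0 u x : (0 <= lip u x)%E.
Proof. by rewrite lipE; apply: le_ereal_inf_tmp => _ [r _ <-]; exact: slope_ge0. Qed.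

Lemma lip_le_slope u x e : 0 < e -> (lip u x <= slope u e x)%E.
Proof. by move=> e0; rewrite lipE; apply: ereal_inf_lbound; exists e. Qed.

Lemma slope_lip_cvg u x : slope u n.+1%:R^-1 x @[n --> \oo] --> lip u x.
Proof.
have := @ereal_nonincreasing_cvgn R (fun n => slope u n.+1%:R^-1 x).
have -> : ereal_inf (range (fun n => slope u n.+1%:R^-1 x)) = lip u x.
  apply/eqP; rewrite eq_le; apply/andP; split; last first.
    by apply: le_ereal_inf_tmp => _ [n _ <-]; apply: lip_le_slope; rewrite invr_gt0.
  rewrite lipE; apply: le_ereal_inf_tmp => _ [e /= e0 <-].
  have [n _ /(_ n (leqnn n)) /= ne] := near_infty_natSinv_lt (PosNum e0).
  apply: (@le_trans _ _ (slope u n.+1%:R^-1 x)).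
    by apply: ereal_inf_lbound; exists n.
  by exact/slope_mono/ltW.
apply => a b ab; apply: slope_mono.
by rewrite lef_pV2 ?posrE// ler_nat.
Qed.

Lemma slope_le_lip u e x L : (forall x y, `|u x - u y| <= L * mdist x y) -> 0 <= L ->
  (slope u e x <= L%:E)%E.
Proof.
by move=> uL L0; apply: slope_leP => // y _; rewrite distrC.
Qed.

(** A difference quotient that exceeds a at x, with the second point y fixed,
    still exceeds a at the points near x: the slope is lower semicontinuous. *)
Lemma slope_borel u e : Lip u -> borel (slope u e).
Proof.
move=> /Lip_ge0P[L L0 uL]; apply: lsc_borel => a.
have [a0|a0] := ltP a 0.
  rewrite (_ : [set _ | _] = setT); first exact: openT.
  by apply/seteqP; split => // x _ /=; rewrite (lt_le_trans _ (slope_ge0 _ _ _)).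
rewrite openE => x /= ax.
have [y [xy yx ay]] : exists y, [/\ mdist x y < e, y <> x &
    a * mdist x y < `|u y - u x|].
  move: ax; rewrite /slope lt_max lte_fin (ltNge a) a0/=.
  move=> /ereal_sup_gt[_ [y [xy yx] <-]]; rewrite lte_fin => ay.
  move: xy; rewrite ballEmdist /= => xy; exists y; split => //.
  by move: ay; rewrite ltr_pdivlMr// mdist_gt0; apply/eqP => /esym.
have d0 : 0 < mdist x y by rewrite mdist_gt0; apply/eqP => /esym.
apply/metricType_numDomainType.nbhs_mdistP.
have aL : 0 < a + L + 1 by rewrite ltr_wpDl// addr_ge0.
exists (Num.min (mdist x y) (Num.min (e - mdist x y)
    ((`|u y - u x| - a * mdist x y) / (a + L + 1)))) => /=.
  by rewrite !lt_min d0 divr_gt0// ?subr_gt0 ?xy.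
move=> z /=; rewrite !lt_min => /and3P[z1 z2]; rewrite ltr_pdivlMr// => z3.
have zy : 0 < mdist z y.
  by have := metric_triangle x z y; move: z1; lra.
have zye : mdist z y < e.
  by have := metric_triangle z x y; rewrite (metric_sym z x); move: z2; lra.
have Hz : a * mdist z y < `|u y - u z|.
  have := uL x z; have := ler_distD (u z) (u y) (u x).
  rewrite (distrC (u z)) => h1 h2.
  have h3 : a * mdist z y <= a * (mdist x z + mdist x y).
    by rewrite ler_wpM2l// (le_trans (metric_triangle _ x _))// (metric_sym z x).
  by have := mdist_ge0 x z; move: z3 h1 h2 h3; lra.
rewrite /slope lt_max; apply/orP; right.
apply: (@lt_le_trans _ _ (`|u y - u z| / mdist z y)%:E).
  by rewrite lte_fin ltr_pdivlMr.
apply: ereal_sup_ubound; exists y => //; rewrite ballEmdist; split => // yz.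
by rewrite yz mdistxx ltxx in zy.
Qed.

(** For y close to x the mean of g x and g y is close to g x. *)
Lemma LUG_lip eps u g x : 0 < eps -> LUG eps u g -> (lip u x <= g x)%E.
Proof.
move=> eps0 [ug [h /Lip_ge0P[L L0 hL] gh]].
rewrite gh /=; apply/lee_addgt0Pr => r r0; rewrite -EFinD.
pose e := Num.min eps (r / (L + 1)).
have L1 : 0 < L + 1 by rewrite ltr_wpDl.
have e0 : 0 < e by rewrite lt_min eps0 divr_gt0.
have h0 y : 0 <= h y by case: ug => _ /(_ y); rewrite gh lee_fin.
apply: (le_trans (lip_le_slope _ _ e0)); apply: slope_leP.
  by rewrite addr_ge0// ltW.
move=> y; rewrite lt_min => /andP[xy1]; rewrite ltr_pdivlMr// => xy2.
have := UG_pair ug (ltW xy1); rewrite gh /= -EFinD -!EFinM lee_fin distrC.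
move=> /le_trans; apply; rewrite ler_wpM2r ?mdist_ge0//.
have := hL x y; rewrite ler_norml => /andP[+ _].
have := mdist_ge0 x y; have := h0 x; move: xy2; nra.
Qed.

End slopes.

(** * Cutoffs in the space L^p *)

Section truncation.
Context {R : realType} {X : metricPType R}.
Variables (m : {outer_measure set X -> \bar R}) (p : R) (p1 : (1 <= p%:E)%E).
Hypothesis rm : radon m.
Hypothesis bm : forall A, metric_bounded A -> (m A < +oo)%E.
Local Notation T := (caratheodory_type m).
Local Notation mu := (cara_measure m).
Local Notation o := (point : X).
Local Notation "'N[ f ]" := (Lp_norm m p (EFin \o f)) (format "''N[' f ]").
Implicit Types (u v w : Lfun_space m p1) (k : R) (x y : X) (f g : X -> R).

Let p0 : 0 < p. Proof. by rewrite (lt_le_trans ltr01)// -lee_fin. Qed.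
Let p1' : 1 <= p. Proof. by rewrite -lee_fin. Qed.

(** The center of the cutoff is an arbitrary point of X. *)
Definition cutoff k x : R := clamp01 (2 - mdist o x / k).
Definition cut k f x : R := cutoff k x * truncr k (f x).

Lemma cutoff_itv k x : 0 <= cutoff k x <= 1.
Proof. by rewrite clamp01_ge0 clamp01_le1. Qed.

Lemma cutoff_eq0 k x : 0 < k -> 2 * k <= mdist o x -> cutoff k x = 0.
Proof.
by move=> k0 kx; apply: clamp01_0; rewrite subr_le0 ler_pdivlMr.
Qed.

Lemma cutoff_eq1 k x : 0 < k -> mdist o x <= k -> cutoff k x = 1.
Proof.
move=> k0 kx; apply: clamp01_1; rewrite lerBrDr -lerBrDl.
by rewrite ler_pdivrMr// (le_trans kx)//; lra.
Qed.

Lemma cutoff_lip k x y : 0 < k -> `|cutoff k x - cutoff k y| <= mdist x y / k.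
Proof.
move=> k0; rewrite (le_trans (clamp01_lip _ _))//.
have -> : 2 - mdist o x / k - (2 - mdist o y / k) = (mdist o y - mdist o x) / k.
  by ring.
by rewrite normrM (gtr0_norm (_ : 0 < k^-1)) ?invr_gt0// ler_pM2r ?invr_gt0// (metric_sym x y) mdist_lip.
Qed.

Lemma cutoff_Lip k : 0 < k -> Lip (cutoff k).
Proof. by move=> k0; exists k^-1 => x y; rewrite mulrC cutoff_lip. Qed.

Lemma cut_le k f x : 0 <= k -> `|cut k f x| <= `|f x|.
Proof.
move=> k0; have /andP[c0 c1] := cutoff_itv k x; rewrite /cut normrM (ger0_norm c0).
by rewrite (le_trans (ler_piMl _ c1))// truncr_norm.
Qed.

Lemma truncr_measurable k f : measurable_fun setT (f : T -> R) ->
  measurable_fun setT ((truncr k \o f) : T -> R).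
Proof.
move=> mf; apply: measurable_maxr; first exact: measurable_cst.
by apply: measurable_minr; first exact: measurable_cst.
Qed.

Lemma cut_measurable k f : 0 < k -> measurable_fun setT (f : T -> R) ->
  measurable_fun setT (cut k f : T -> R).
Proof.
move=> k0 mf; apply: measurable_funM; last exact: truncr_measurable.
by apply: Lip_measurable => //; exact: cutoff_Lip.
Qed.

(** At every point cut k v = v for large k, and |v| dominates the difference. *)
Lemma cut_approx v (d : R) : 0 < d ->
  \forall k \near \oo, (Lp_norm m p (fun x => (cut k.+1%:R v x - v x)%:E) <= d%:E)%E.
Proof.
move=> d0; have mv := Lfun_measurable v.
pose F n x := (`|cut n.+1%:R v x - v x| `^ p)%:E.
have mF n : measurable_fun setT (F n : T -> \bar R).
  apply/measurable_EFinP; apply: (measurableT_comp (measurable_powR _)).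
  apply: measurableT_comp => //; apply: measurable_funB => //.
  exact: cut_measurable.
have F0 x : F n x @[n --> \oo] --> 0%E.
  apply: (cvg_trans _ (@cvg_cst _ (0%E : \bar R) _ \oo _)).
  apply: near_eq_cvg; near=> n.
  have nv : `|v x| <= n.+1%:R.
    by rewrite ltW//; near: n; apply: filterS (nbhs_infty_gtr `|v x|) => n /lt_le_trans; apply; rewrite ler_nat.
  have nx : mdist o x <= n.+1%:R.
    by rewrite ltW//; near: n; apply: filterS (nbhs_infty_gtr (mdist o x)) => n /lt_le_trans; apply; rewrite ler_nat.
  by rewrite /F /cut cutoff_eq1// truncr_id// mul1r subrr normr0 powR0// gt_eqF.
have iv : mu.-integrable setT (fun x => (`|v x| `^ p)%:E).
  apply/integrableP; split.
    apply/measurable_EFinP; apply: (measurableT_comp (measurable_powR _)).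
    exact: measurableT_comp.
  under eq_integral do rewrite gee0_abs ?lee_fin ?powR_ge0//.
  have := @poweR_Lnorm _ _ _ mu (EFin \o v) _ (lt0r_neq0 p0).
  move=> /= <-; apply: poweR_lty; exact: Lfun_norm_fin.
have dom x n : [set: T] x -> (`|F n x| <= (`|v x| `^ p)%:E)%E.
  move=> _; rewrite /F gee0_abs ?lee_fin ?powR_ge0//.
  rewrite ge0_ler_powR ?nnegrE ?(ltW p0)//.
  by apply: cut_trunc_dist => //; exact: cutoff_itv.
have [_ _] := dominated_convergence measurableT mF (measurable_cst 0%E)
  (aeW mu (fun x _ => F0 x)) iv (aeW mu dom).
rewrite integral0 => cv.
have dp : (0%E < (d `^ p)%:E)%E by rewrite lte_fin powR_gt0.
have cva : \forall n \near \oo, (\int[mu]_x F n x < (d `^ p)%:E)%E.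
  exact: (cv _ (open_ereal_lt' dp)).
apply: filterS cva => n Fn; apply/(Lnorm_leP _ p0); first exact: ltW.
exact: ltW.
Unshelve. all: by end_near. Qed.

Lemma Lp_norm_le f g : measurable_fun setT (f : T -> R) ->
  measurable_fun setT (g : T -> R) -> (forall x, `|f x| <= `|g x|) ->
  ('N[f] <= 'N[g])%E.
Proof.
by move=> mf mg fg; apply: (le_Lnorm _ p0) => [||x]; rewrite ?lee_fin//;
  exact/measurable_EFinP.
Qed.

Lemma Lp_normD f g : measurable_fun setT (f : T -> R) ->
  measurable_fun setT (g : T -> R) ->
  ('N[(fun x => f x + g x)%R] <= 'N[f] + 'N[g])%E.
Proof. by move=> mf mg; exact: (eminkowski mu mf mg p1). Qed.

(** Integrated form of [LUG_lip]; lip v is measurable as a limit of slopes. *)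
Lemma F_AGS_le_CLip v : (F_AGS m p1 v <= F_CLip m p1 v)%E.
Proof.
apply: F_CLip_ge => lv eps g e0 ug; rewrite /F_AGS; case: asboolP => // _.
have ms n : measurable_fun setT (slope v n.+1%:R^-1 : T -> \bar R).
  by apply: borel_cara => //; exact: slope_borel.
apply: (le_Lnorm _ p0).
- apply: (emeasurable_fun_cvg _ _ ms) => x _; exact: slope_lip_cvg.
- by apply: borel_cara => //; case: ug => -[].
- move=> x; have lg := LUG_lip x e0 ug.
  by rewrite !gee0_abs ?lip_ge0// (le_trans (lip_ge0 _ _) lg).
Qed.

End truncation.

(** * From the local Lipschitz constant to chains *)

Section upper_slope.
Context {R : realType} {X : metricPType R}.
Variables (m : {outer_measure set X -> \bar R}) (p : R) (p1 : (1 <= p%:E)%E).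
Hypothesis rm : radon m.
Hypothesis bm : forall A, metric_bounded A -> (m A < +oo)%E.
Local Notation T := (caratheodory_type m).
Local Notation mu := (cara_measure m).
Local Notation o := (point : X).
Local Notation "'N[ f ]" := (Lp_norm m p (EFin \o f)) (format "''N[' f ]").
Implicit Types (u v w : Lfun_space m p1) (k : R) (x y : X) (f g : X -> R).

Let p0 : 0 < p. Proof. by rewrite (lt_le_trans ltr01)// -lee_fin. Qed.
Let p1' : 1 <= p. Proof. by rewrite -lee_fin. Qed.

Lemma Lp_norm_subrr f : Lp_norm m p (fun x => (f x - f x)%:E) = 0%E.
Proof.
rewrite /Lp_norm -(@Lnorm0 _ _ _ mu p%:E); last by rewrite eqe gt_eqF.
by apply: eq_Lnorm => x; rewrite subrr.
Qed.

Lemma cut_Lfun k v : 0 < k -> exists w : Lfun_space m p1, cut k v = w.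
Proof.
move=> k0; have mc := cut_measurable rm k0 (Lfun_measurable v).
apply: Lfun_of => //; apply: le_lt_trans (Lfun_norm_fin v).
apply: (Lp_norm_le p1 mc (Lfun_measurable v)) => x.
by rewrite cut_le// ltW.
Qed.

Lemma near_Lp_norm_div v (d : R) : 0 < d ->
  \forall n \near \oo, ((n.+1%:R^-1)%:E * 'N[v] <= d%:E)%E.
Proof.
move=> d0; have := Lfun_norm_fin v; have := Lnorm_ge0 mu p%:E (EFin \o v).
rewrite /Lp_norm; case: (Lnorm _ _ _) => [a|//|//]; rewrite lee_fin => a0 _.
near=> n; rewrite -EFinM lee_fin mulrC ler_pdivrMr// mulrC -ler_pdivrMr//.
rewrite ltW//; near: n; apply: filterS (nbhs_infty_gtr (a / d)) => n /lt_le_trans.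
by apply; rewrite ler_nat.
Unshelve. all: by end_near. Qed.

Lemma Lp_norm_div v k : 0 < k -> 'N[(fun x => k^-1 * `|v x|)%R] = ((k^-1)%:E * 'N[v])%E.
Proof.
move=> k0; rewrite /Lp_norm (LnormMl _ p0).
- congr (_ * _)%E; exact: (Lnorm_abse mu (EFin \o v)).
- apply: measurableT_comp => //; exact: Lfun_measurable.
- by rewrite invr_ge0 ltW.
Qed.

(** For w = cut K v and B the ball of radius 2 K + 1, the function equal on B to the
    slope of v at scale 1/(j+1) plus |v| / K is a chain upper gradient of w.  The
    slopes converge to lip v in L^p(B), as they are bounded by the Lipschitz
    constant of v. *)
Lemma F_C_approx_AGS v (d : R) : 0 < d -> exists w,
  (Lp_norm m p (fun x => (w x - v x)%:E) <= d%:E)%E /\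
  (F_C m p1 w <= F_AGS m p1 v + d%:E)%E.
Proof.
move=> d0; have [->|] := eqVneq (F_AGS m p1 v) +oo%E.
  by exists v; rewrite Lp_norm_subrr lee_fin ltW// addye// leey.
rewrite /F_AGS; case: asboolP => // lv _.
have d2 : 0 < d / 2 by rewrite divr_gt0.
have mv := Lfun_measurable v.
near \oo => n; have nA : (Lp_norm m p (fun x => (cut n.+1%:R v x - v x)%:E) <= d%:E)%E.
  by near: n; exact: cut_approx.
have nB : ((n.+1%:R^-1)%:E * 'N[v] <= (d / 2)%:E)%E.
  by near: n; exact: near_Lp_norm_div.
pose K : R := n.+1%:R.
have K0 : 0 < K by [].
have [w wE] := cut_Lfun v K0.
exists w; rewrite -wE; split => //.
have [L L0 vL] := Lip_ge0P lv.
have slfin e x : slope v e x \is a fin_num.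
  rewrite ge0_fin_numE ?slope_ge0// (le_lt_trans (slope_le_lip _ _ vL L0))//.
  by rewrite ltry.
have lip_slope j x : (lip v x <= slope v j.+1%:R^-1 x)%E.
  by apply: lip_le_slope; rewrite invr_gt0.
have lipfin x : lip v x \is a fin_num.
  rewrite ge0_fin_numE ?lip_ge0// (le_lt_trans (lip_slope 0%N x))//.
  by rewrite -ge0_fin_numE ?slope_ge0.
pose s j x := fine (slope v j.+1%:R^-1 x); pose l x := fine (lip v x).
have sE j : EFin \o s j = slope v j.+1%:R^-1.
  by apply/funext => x /=; rewrite fineK.
have lE : EFin \o l = lip v by apply/funext => x /=; rewrite fineK.
have ms j : measurable_fun setT (s j : T -> R).
  by apply/measurable_EFinP; rewrite sE; apply: borel_cara => //; exact: slope_borel.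
have ml : measurable_fun setT (l : T -> R).
  apply/measurable_EFinP; rewrite lE; apply: (emeasurable_fun_cvg
    (fun n => (slope v n.+1%:R^-1 : T -> \bar R))) => [j|x _].
    by apply: borel_cara => //; exact: slope_borel.
  exact: slope_lip_cvg.
have l0 x : 0 <= l x by rewrite fine_ge0// lip_ge0.
have s0 j x : 0 <= s j x by rewrite fine_ge0// slope_ge0.
have ls j x : l x <= s j x by rewrite fine_le.
have sL j x : s j x <= L by rewrite -lee_fin fineK// slope_le_lip.
pose B : set X := ball o (2 * K + 1).
have oB : open B by exact: open_metric_ball.
have mB : measurable (B : set T) by exact: open_cara.
have mB' : measurable (B : set (g_sigma_algebraType (@open X))).
  exact: sub_sigma_algebra.
have Boo : (m B < +oo)%E by apply: bm; exists o, (2 * K + 1).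
have [j Nj] : exists j, ('N[(fun x => \1_B x * (s j x - l x))%R] <= (d / 2)%:E)%E.
  have := @Lnorm_indic_cvg0 _ T R mu p B p1' mB (fun j x => s j x - l x) L _ Boo d2.
  case; first by move=> j; exact: measurable_funB.
  - by move=> j x _; rewrite ger0_norm ?subr_ge0// lerBlDr (le_trans (sL j x))// lerDl.
  - move=> x _; rewrite -(subrr (l x)); apply: cvgB; last exact: cvg_cst.
    apply: fine_cvg; rewrite -/(l x) fineK//; exact: slope_lip_cvg.
  by move=> N _ /(_ N (leqnn N)); exists N.
pose h x := \1_B x * (s j x + K^-1 * `|v x|).
pose e : R := j.+1%:R^-1 / 2.
have j0 : 0 < j.+1%:R^-1 :> R by rewrite invr_gt0.
have e0 : 0 < e by rewrite divr_gt0.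
have ej : e < j.+1%:R^-1 by rewrite /e ltr_pdivrMr// ltr_pMr// ltr1n.
have j1 : j.+1%:R^-1 <= 1 :> R by rewrite invf_le1// ler1n.
have h0 x : 0 <= h x.
  by rewrite mulr_ge0// addr_ge0// mulr_ge0// invr_ge0 ltW.
(* If one end of a step is at distance at least 2 K + 1 from the center, both ends
   lie where the cutoff vanishes. *)
have half x y : mdist x y <= e -> `|cut K v x - cut K v y| <= h x * mdist x y.
  move=> xy; have xye : mdist x y < j.+1%:R^-1 by exact: le_lt_trans ej.
  have [xB|xB] := ltP (mdist o x) (2 * K + 1); last first.
    have hx0 : 0 <= h x * mdist x y by rewrite mulr_ge0 ?mdist_ge0.
    have xB' : 2 * K <= mdist o x by rewrite (le_trans _ xB)// lerDl.
    have yB' : 2 * K <= mdist o y.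
      have := metric_triangle o y x; rewrite (metric_sym y).
      by move: (ltW (lt_le_trans xye j1)) xB; lra.
    by rewrite /cut !cutoff_eq0// !mul0r subrr normr0.
  have -> : h x = s j x + K^-1 * `|v x|.
    by rewrite /h indicE mem_set ?mul1r//= /B ballEmdist.
  rewrite (le_trans (dist_mul_side _ _ _ (cutoff_itv _ _)))// mulrDl lerD//.
    rewrite (le_trans (truncr_lip _ _ (ltW K0)))// distrC.
    by have := slope_ge v xye; rewrite -(fineK (slfin _ _)) -EFinM lee_fin.
  rewrite -mulrA mulrCA ler_pM// ?truncr_norm ?(ltW K0)//.
  by rewrite mulrC cutoff_lip.
have ugh : UG e w (EFin \o h).
  apply: pair_UG.
  - apply/measurable_EFinP; apply: measurable_funM; first exact: measurable_indic.
    apply: measurable_funD; first by apply/measurable_EFinP; rewrite sE; exact: slope_borel.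
    apply: measurable_funM; first exact: measurable_cst.
    by apply: measurableT_comp => //; apply/measurable_EFinP; exact: Lip_borel.
  - by move=> x; rewrite lee_fin.
  - move=> x y xy; rewrite /= -EFinD -!EFinM lee_fin -wE.
    have := half x y xy; have := half y x; rewrite metric_sym (distrC (cut K v y)).
    by move=> /(_ xy); lra.
apply: (le_trans (F_C_le e0 ugh)).
have mind f : measurable_fun setT (f : T -> R) ->
    measurable_fun setT ((fun x => \1_B x * f x) : T -> R).
  by move=> mf; apply: measurable_funM => //; exact: measurable_indic.
have ind1 x : 0 <= (\1_B x : R) <= 1.
  by rewrite indicE; case: (_ \in _); rewrite /= ?lexx ?ler01.
have mabs : measurable_fun setT ((fun x => K^-1 * `|v x|) : T -> R).
  by apply: measurable_funM; [exact: measurable_cst|exact: measurableT_comp].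
have indle f x : `|\1_B x * f x| <= `|f x|.
  have /andP[i0 i1] := ind1 x.
  by rewrite normrM (ger0_norm i0) ler_piMl.
have -> : h = (fun x => (\1_B x * l x + \1_B x * (s j x - l x)) + \1_B x * (K^-1 * `|v x|)).
  by apply/funext => x; rewrite /h; ring.
have msl : measurable_fun setT ((fun x => s j x - l x) : T -> R) by exact: measurable_funB.
apply: (le_trans (Lp_normD p1 (measurable_funD (mind _ ml) (mind _ msl)) (mind _ mabs))).
rewrite (splitr d) EFinD addeA leeD//.
  apply: (le_trans (Lp_normD p1 (mind _ ml) (mind _ msl))).
  rewrite leeD// -lE; exact: (Lp_norm_le p1 (mind _ ml) ml (indle l)).
apply: (le_trans (Lp_norm_le p1 (mind _ mabs) mabs (indle _))).
by rewrite Lp_norm_div.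
Unshelve. all: by end_near. Qed.

End upper_slope.

(** * Approximation by Lipschitz pairs on a set of finite measure *)

Section bounded_approximation.
Context {R : realType} {X : metricPType R}.
Variables (m : {outer_measure set X -> \bar R}) (p : R).
Hypotheses (p1 : 1 <= p) (rm : radon m).
Variable (Y : set X).
Hypotheses (oY : open Y) (mY : (m Y < +oo)%E).
Local Notation T := (caratheodory_type m).
Local Notation mu := (cara_measure m).
Implicit Types (x y : X).

Let p0 : 0 < p. Proof. exact: lt_le_trans p1. Qed.
Let mYm : measurable (Y : set T). Proof. exact: open_cara. Qed.

(** [lsc_majorant] for the p-th power of g, followed by the p-th root. *)
Lemma lsc_majorant_powR (g : X -> \bar R) (c : R) : borel g ->
  (forall x, (0 <= g x)%E) -> (\int[mu]_(x in Y) (g x `^ p) < c%:E)%E ->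
  exists (G : X -> \bar R) (eta : R), [/\ 0 < eta,
    (forall y, (eta%:E <= G y)%E),
    (forall y, Y y -> (g y <= G y)%E),
    (forall a : R, compact [set y | (G y <= a%:E)%E] /\
       [set y | (G y <= a%:E)%E] `<=` Y) &
    (\int[mu]_(x in Y) (G x `^ p) <= c%:E)%E].
Proof.
move=> bg g0 gc.
have mg : measurable_fun setT ((fun x => g x `^ p)%E : T -> \bar R).
  by apply: (measurableT_comp (measurable_poweR _)); exact: borel_cara.
have [P [eta [eta0 etaP gP cP Pc]]] :=
  lsc_majorant rm oY mY mg (fun x => poweR_ge0 _ _) gc.
have pV : p^-1 != 0 by rewrite invr_neq0// gt_eqF.
have P0 x : (0 <= P x)%E by rewrite (le_trans _ (etaP x))// lee_fin ltW.
have pVp (a : \bar R) : (0 <= a)%E -> ((a `^ p^-1) `^ p = a)%E.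
  by move=> a0; rewrite -poweRrM mulVf ?gt_eqF// poweRe1.
have ppV (a : \bar R) : (0 <= a)%E -> ((a `^ p) `^ p^-1 = a)%E.
  by move=> a0; rewrite -poweRrM mulfV ?gt_eqF// poweRe1.
have pV0 : 0 <= p^-1 by rewrite invr_ge0 ltW.
exists (fun x => P x `^ p^-1)%E, (eta `^ p^-1); split => //.
- by rewrite powR_gt0.
- by move=> y; rewrite -poweR_EFin ge0_le_poweR// lee_fin ltW.
- by move=> y Yy; rewrite -(ppV (g y))// ge0_le_poweR ?poweR_ge0 ?gP.
- move=> a; have [a0|a0] := ltP a 0.
    rewrite (_ : [set _ | _] = set0); first by split; [exact: compact0|].
    apply/seteqP; split => // y /=; rewrite leNgt (lt_le_trans _ (poweR_ge0 _ _))//.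
  have -> : [set y | (P y `^ p^-1 <= a%:E)%E] = [set y | (P y <= (a `^ p)%:E)%E].
    apply/seteqP; split => y /=; rewrite -poweR_EFin => Pa.
      by rewrite -(pVp (P y))// ge0_le_poweR ?poweR_ge0 ?(ltW p0).
    by rewrite -(ppV a%:E) ?lee_fin// ge0_le_poweR.
  exact: cP.
- by under eq_integral do rewrite pVp//.
Qed.

(** Chebyshev's inequality for the p-th power of G. *)
Lemma superlevel_measure (G : X -> \bar R) (C c : R) : 0 <= C ->
  measurable_fun setT (G : T -> \bar R) -> (forall x, (0 <= G x)%E) ->
  (\int[mu]_(x in Y) (G x `^ p) <= c%:E)%E ->
  ((C `^ p)%:E * m (Y `&` [set x | (C%:E < G x)%E]) <= c%:E)%E.
Proof.
move=> C0 mG G0; apply: le_trans.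
have mGp : measurable_fun (Y : set T) ((fun x => G x `^ p)%E : T -> \bar R).
  by apply: measurable_funTS; exact: (measurableT_comp (measurable_poweR _)).
have mE : measurable (Y `&` [set x | (C%:E < G x)%E] : set T).
  by apply: emeasurable_fun_o_infty => //; exact: measurable_funTS.
apply: (@le_trans _ _ (\int[mu]_(x in Y `&` [set x | (C%:E < G x)%E]) (G x `^ p))%E).
  rewrite -(integral_cst mu mE); apply: ge0_le_integral => //.
  - by move=> x _; rewrite lee_fin powR_ge0.
  - by apply: (measurable_funS mYm _ mGp) => x [].
  - move=> x [_ /= Cx]; rewrite -poweR_EFin; apply: gt0_ler_poweR => //.
    + exact: ltW.
    + by rewrite in_itv/= leey andbT lee_fin.
    + by rewrite in_itv/= leey andbT.
    + exact: ltW.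
by apply: ge0_subset_integral => // x _; exact: poweR_ge0.
Qed.

(** f is a Lipschitz regularization of the majorant G of g, and w the corresponding
    infimum over chains.  Its end values S are the majorant S0 of u where G <= C
    and the largest value M elsewhere; in this way chains of value less than M end
    in a compact set on which G is bounded.  The error w - u is bounded by the
    sum of S0 - u, which is small in L^1, of 2 M on the set where G > C, which
    has small measure, and of the positive part of u - w where G <= C, which
    tends to 0 as j grows by [chain_inf_liminf]. *)
Lemma lipschitz_pair_approx (u : X -> R) (g : X -> \bar R) (M eps c e : R) :
  0 < M -> (forall x, `|u x| <= M) -> measurable_fun setT (u : T -> R) ->
  borel g -> (forall x, (0 <= g x)%E) -> 0 < eps ->
  (forall x y, mdist x y <= eps ->
    (`|u x - u y|%:E <= (g x + g y) * (2^-1)%:E * (mdist x y)%:E)%E) ->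
  (\int[mu]_(x in Y) (g x `^ p) < c%:E)%E -> 0 < c -> 0 < e ->
  exists (f w : X -> R) (r : R), [/\ 0 < r <= 1,
    [/\ Lip f, Lip w, exists A, forall x, `|f x| <= A & forall x, `|w x| <= M],
    forall x, 0 <= f x,
    forall x y, mdist x y <= r -> `|w x - w y| <= (f x + f y) / 2 * mdist x y &
    (\int[mu]_(x in Y) (`|f x| `^ p)%:E <= c%:E)%E /\
    (Lp_norm m p (fun x => (\1_Y x * (w x - u x))%:E) <= e%:E)%E].
Proof.
move=> M0 uM meas_u bg g0 eps0 ug gc c0 e0.
have [G [eta [eta0 etaG gG cG Gc]]] := lsc_majorant_powR bg g0 gc.
have G0 x : (0 <= G x)%E by rewrite (le_trans _ (etaG x))// lee_fin ltW.
have mG := borel_cara rm (compact_sublevel_borel (fun b => proj1 (cG b))).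
have uM1 x : - M <= u x <= M by rewrite -ler_norml.
have up0 x : (0 <= (u x + M)%:E)%E.
  by rewrite lee_fin; have /andP[] := uM1 x; lra.
have mup : measurable_fun setT ((fun x => (u x + M)%:E) : T -> \bar R).
  by apply/measurable_EFinP; exact: measurable_funD.
have e2 : 0 < e / 2 by rewrite divr_gt0.
(* By [Lnorm_indic_bounded] an L^1 norm at most a of a function bounded by 4 M
   gives an L^p norm at most e / 2. *)
pose a := (e / 2) `^ p / ((4 * M) `^ (p - 1) + 1).
have a0 : 0 < a by rewrite divr_gt0 ?powR_gt0// ltr_wpDl// powR_ge0.
pose t := a / 2; have t0 : 0 < t by rewrite divr_gt0.
pose I := (\int[mu]_(x in Y) (u x + M)%:E)%E.
have Ifin : I \is a fin_num.
  rewrite ge0_fin_numE; last by apply: integral_ge0 => x _.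
  apply: (@le_lt_trans _ _ (\int[mu]_(x in Y) cst (2 * M)%:E x)%E).
    apply: ge0_le_integral => //; first exact: measurable_funTS.
    by move=> x _; rewrite lee_fin; have /andP[] := uM1 x; lra.
  by rewrite integral_cst// lte_mul_pinfty// ?lee_fin// mulr_ge0// ltW.
have It : (I < (fine I + t)%:E)%E by rewrite -(fineK Ifin) lte_fin ltrDl.
have [U [_ [_ _ uU cU Ut]]] := lsc_majorant rm oY mY mup up0 It.
have U0 x : (0 <= U x)%E.
  have [Yx|nY] := pselect (Y x); first by rewrite (le_trans (up0 x) (uU x Yx)).
  by rewrite leNgt; apply/negP => /ltW U0; apply: nY; have [_ +] := cU 0; apply.
(* U majorizes u + M, which takes values in [0, 2 M]. *)
pose S0 q := fine (mine (U q) (2 * M)%:E) - M.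
have M2 : 0 <= 2 * M by rewrite mulr_ge0// ltW.
have S0E q : (S0 q + M)%:E = mine (U q) (2 * M)%:E.
  rewrite /S0 subrK fineK// ge0_fin_numE ?le_min ?U0 ?lee_fin//.
  by rewrite (le_lt_trans _ (ltry (2 * M)))// ge_min lexx orbT.
have S0M q : - M <= S0 q <= M.
  have := ge_min (mine (U q) (2 * M)%:E) (U q) (2 * M)%:E; rewrite lexx.
  have : (0%:E <= (S0 q + M)%:E)%E by rewrite S0E le_min U0 lee_fin.
  have : ((S0 q + M)%:E <= (2 * M)%:E)%E by rewrite S0E ge_min lexx orbT.
  by rewrite !lee_fin => h1 h2 _; apply/andP; split; lra.
have uS0 q : Y q -> u q <= S0 q.
  move=> Yq; have : ((u q + M)%:E <= (S0 q + M)%:E)%E.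
    by rewrite S0E le_min uU// lee_fin; have /andP[] := uM1 q; lra.
  by rewrite lee_fin lerD2r.
have S0U q : ((S0 q + M)%:E <= U q)%E by rewrite S0E ge_min lexx.
have S0le b q : b < M -> (S0 q <= b) = (U q <= (b + M)%:E)%E.
  move=> bM; rewrite -(lerD2r M) -lee_fin S0E ge_min lee_fin.
  by rewrite [X in _ || X](_ : _ = false) ?orbF//; apply/negbTE; rewrite -ltNge; lra.
have mU := borel_cara rm (compact_sublevel_borel (fun b => proj1 (cU b))).
have mS0 : measurable_fun setT (S0 : T -> R).
  apply: measurable_funB; last exact: measurable_cst.
  by apply: measurableT_comp => //; apply: measurable_mine.
(* By Chebyshev's inequality 2 M times the measure of the set where G > C is at
   most t. *)
pose C := (2 * M * c / t) `^ p^-1.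
have CC : C `^ p = 2 * M * c / t.
  by rewrite -powRrM mulVf ?gt_eqF// powRr1// !mulr_ge0 ?invr_ge0 ?(ltW t0) ?(ltW c0) ?(ltW M0).
have C0 : 0 <= C by exact: powR_ge0.
pose S q := if (G q <= C%:E)%E then S0 q else M.
have SM q : - M <= S q <= M.
  by rewrite /S; case: ifP => // _; rewrite lexx andbT; lra.
have clG b : closed [set y | (G y <= b%:E)%E].
  by apply: compact_closed; [exact: metric_hausdorff|case: (cG b)].
have clU b : closed [set y | (U y <= b%:E)%E].
  by apply: compact_closed; [exact: metric_hausdorff|case: (cU b)].
have clS b : closed [set q | S q <= b].
  have [Mb|bM] := leP M b.
    rewrite (_ : [set _ | _] = setT); first exact: closedT.
    by apply/seteqP; split => // q _ /=; rewrite (le_trans _ Mb)//; case/andP: (SM q).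
  rewrite (_ : [set _ | _] = [set y | (G y <= C%:E)%E] `&` [set y | (U y <= (b + M)%:E)%E]).
    exact: closedI.
  apply/seteqP; split => q /=; rewrite /S.
    by case: ifP => [Gq|_]; [rewrite S0le|rewrite leNgt bM].
  by move=> [Gq Uq]; rewrite Gq S0le.
have GY b x : (G x <= b%:E)%E -> Y x by move=> Gx; have [_ +] := cG b; apply.
have uS x : (G x <= C%:E)%E -> u x <= S x.
  by move=> Gx; rewrite /S Gx; apply: uS0; exact: GY Gx.
have SC x : S x < M -> (G x <= C%:E)%E.
  by rewrite /S; case: ifP => //; rewrite ltxx.
have uG x y b1 b2 : mdist x y <= eps -> (G x <= b1%:E)%E -> (G y <= b2%:E)%E ->
    `|u x - u y| <= (b1 + b2) / 2 * mdist x y.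
  move=> xy Gx Gy; have := ug x y xy.
  have : (g x <= b1%:E)%E by rewrite (le_trans _ Gx)// gG//; exact: GY Gx.
  have : (g y <= b2%:E)%E by rewrite (le_trans _ Gy)// gG//; exact: GY Gy.
  move=> gy gx /le_trans le; rewrite -lee_fin; apply: le.
  rewrite !EFinM EFinD lee_wpmul2r ?lee_fin ?mdist_ge0//.
  by rewrite lee_wpmul2r ?lee_fin// leeD.
pose f j := lip_reg G j; pose w j := chain_inf (f j) S j.+1%:R^-1.
have key x d : (G x <= C%:E)%E -> 0 < d -> \forall j \near \oo, u x - d <= w j x.
  move=> Gx d0; exact: (chain_inf_liminf eta0 etaG (fun b => proj1 (cG b)) eps0
    uG SM uM clS uS SC Gx d0).
have f0 j x : 0 <= f j x by exact: lip_reg_ge0.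
have SM1 q : - M <= S q by case/andP: (SM q).
have wM j x : `|w j x| <= M.
  rewrite ler_norml (chain_inf_ge _ (f0 j) SM1)/=.
  by rewrite (le_trans (chain_inf_leS _ (f0 j) SM1 x))//; case/andP: (SM x).
have wstep j x y : mdist x y <= j.+1%:R^-1 ->
    `|w j x - w j y| <= (f j x + f j y) / 2 * mdist x y.
  by move=> xy; exact: (chain_inf_step (f0 j) SM1).
have fj j x : f j x <= j%:R by exact: lip_reg_len.
have wLip j : Lip (w j).
  apply: (@Lip_local_bounded _ _ _ j%:R M j.+1%:R^-1) => //.
  move=> x y xy; rewrite (le_trans (wstep j x y xy))// ler_wpM2r ?mdist_ge0//.
  by have := fj j x; have := fj j y; lra.
have fLip j : Lip (f j) by exists j%:R; exact: lip_reg_lip.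
have mw j := Lip_measurable rm (wLip j).
pose K : set X := [set x | (G x <= C%:E)%E].
have mK : measurable (K : set T) by apply: closed_cara => //; exact: clG.
have mKc : measurable (~` K : set T) by exact: measurableC.
have inK x : (x \in K) = (G x <= C%:E)%E by apply/idP/idP; rewrite inE.
have inKc x : (x \in ~` K) = ~~ (G x <= C%:E)%E by rewrite in_setC inK.
pose excess x := (S0 x - u x) + 2 * M * \1_(~` K) x.
pose deficit j x := \1_K x * Num.max 0 (u x - w j x).
have me1 : measurable_fun setT (excess : T -> R).
  apply: measurable_funD; first exact: measurable_funB.
  by apply: measurable_funM; [exact: measurable_cst|exact: measurable_indic].
have me2 j : measurable_fun setT (deficit j : T -> R).
  apply: measurable_funM; first exact: measurable_indic.
  by apply: measurable_maxr; [exact: measurable_cst|exact: measurable_funB].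
have excess_itv x : Y x -> 0 <= excess x <= 4 * M.
  move=> Yx; rewrite /excess; have := uS0 x Yx; have /andP[_ ?] := S0M x.
  have /andP[? _] := uM1 x; rewrite indicE; case: (_ \in _) => /=; lra.
have err j x : Y x -> `|w j x - u x| <= excess x + deficit j x.
  move=> Yx; rewrite /excess /deficit !indicE inK inKc; have := uS0 x Yx.
  have := wM j x; have := uM x; rewrite !ler_norml.
  have [Gx|Gx] := boolP (G x <= C%:E)%E.
    have := chain_inf_leS j.+1%:R^-1 (f0 j) SM1 x; rewrite -/(w j) /S Gx.
    rewrite /= mulr0 addr0 mul1r => ? ? ? ?.
    have : u x - w j x <= Num.max 0 (u x - w j x) by rewrite le_max lexx orbT.
    have : 0 <= Num.max 0 (u x - w j x) by rewrite le_max lexx.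
    by lra.
  by rewrite /= mul0r; lra.
have s1 : (\int[mu]_(x in Y) (S0 x - u x)%:E <= t%:E)%E.
  rewrite -(leeD2rE _ _ Ifin) /I -ge0_integralD//.
  - rewrite (eq_integral (fun x : T => (S0 x + M)%:E)); last first.
      by move=> x _; rewrite -EFinD; congr EFin; ring.
    apply: (@le_trans _ _ (\int[mu]_(x in Y) U x)%E).
      apply: ge0_le_integral => //.
      + by move=> x _; rewrite lee_fin; have /andP[] := S0M x; lra.
      + by apply: measurable_funTS; apply/measurable_EFinP; exact: measurable_funD.
      + by apply: measurable_funTS; exact: mU.
    by apply: (le_trans Ut); rewrite EFinD fineK// addeC.
  - by move=> x Yx; rewrite lee_fin subr_ge0 uS0.
  - by apply/measurable_EFinP; apply: measurable_funTS; exact: measurable_funB.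
  - exact: measurable_funTS.
have mi2 : measurable_fun setT ((fun x => (2 * M * \1_(~` K) x)%:E) : T -> \bar R).
  apply/measurable_EFinP; apply: measurable_funM; first exact: measurable_cst.
  exact: measurable_indic.
have s2 : (\int[mu]_(x in Y) (2 * M * \1_(~` K) x)%:E <= t%:E)%E.
  under eq_integral do rewrite EFinM.
  rewrite ge0_integralZl//; last first.
    by apply/measurable_EFinP; exact: measurable_indic.
  rewrite integral_indic//.
  have := superlevel_measure C0 mG G0 Gc; rewrite CC.
  have -> : Y `&` [set x | (C%:E < G x)%E] = ~` K `&` Y.
    rewrite setIC; congr (_ `&` _); apply/seteqP; split => x /=; rewrite ltNge => /negP.
      by [].
    by [].
  have ct : 0 < t / c by rewrite divr_gt0.
  move=> /(lee_wpmul2l (ltW (_ : (0 < (t / c)%:E)%E))); rewrite lte_fin => /(_ ct).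
  rewrite muleA -!EFinM.
  have -> : t / c * (2 * M * c / t) = 2 * M by field; rewrite !gt_eqF.
  by rewrite divfK// gt_eqF.
have Ne1 : (Lp_norm m p (fun x => (\1_Y x * excess x)%:E) <= (e / 2)%:E)%E.
  apply: (@Lnorm_indic_bounded _ T R mu p Y p1 mYm excess (4 * M) a).
  - exact: me1.
  - exact: ltW.
  - by move=> x /excess_itv/andP[h1 h2]; rewrite ger0_norm.
  - have aE : a%:E = (t%:E + t%:E)%E by rewrite -EFinD -splitr.
    rewrite aE; apply: le_trans (leeD s1 s2).
    rewrite -ge0_integralD//.
    + rewrite le_eqVlt; apply/orP; left; apply/eqP; apply: eq_integral => x.
      by rewrite inE => /excess_itv/andP[h1 _]; rewrite ger0_norm// -EFinD.
    + by move=> x Yx; rewrite lee_fin subr_ge0 uS0.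
    + by apply/measurable_EFinP; apply: measurable_funTS; exact: measurable_funB.
    + by move=> x _; rewrite lee_fin mulr_ge0.
    + by apply: measurable_funTS; exact: mi2.
  - rewrite /a mulrCA ler_piMr ?powR_ge0// ler_pdivrMr ?mul1r ?lerDl//.
    by rewrite ltr_wpDl// powR_ge0.
have [j Nj] : exists j, (Lp_norm m p (fun x => (\1_Y x * deficit j x)%:E) <= (e / 2)%:E)%E.
  have := @Lnorm_indic_cvg0 _ T R mu p Y p1 mYm deficit (2 * M) _ mY e2 me2.
  case; last by move=> N _ /(_ N (leqnn N)); exists N.
  - move=> k x _; rewrite /deficit indicE normrM.
    have h0 : 0 <= Num.max 0 (u x - w k x) by rewrite le_max lexx.
    have hM : Num.max 0 (u x - w k x) <= 2 * M.
      rewrite ge_max M2/=; have := wM k x; have := uM x.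
      by rewrite !ler_norml; lra.
    rewrite (ger0_norm h0); case: (_ \in _); first by rewrite normr1 mul1r.
    by rewrite normr0 mul0r.
  - move=> x _; apply/cvgrPdist_le => d d0; rewrite /deficit indicE inK.
    have [Gx|_] := boolP (G x <= C%:E)%E; last first.
      by apply: nearW => k; rewrite mul0r subrr normr0 ltW.
    apply: filterS (key x d Gx d0) => k uk.
    rewrite mul1r sub0r normrN ger0_norm ?le_max ?lexx// ge_max (ltW d0)/=; lra.
exists (f j), (w j), j.+1%:R^-1; split => //.
- by rewrite invr_gt0 ltr0n invf_le1// ler1n.
- by split => //; exists j%:R => x; rewrite ger0_norm.
- exact: wstep.
split.
  apply: le_trans Gc; apply: ge0_le_integral => //.
  - apply/measurable_EFinP; apply: (measurableT_comp (measurable_powR _)).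
    by apply: measurableT_comp => //; apply: measurable_funTS; exact: Lip_measurable.
  - by apply: measurable_funTS; exact: (measurableT_comp (measurable_poweR _)).
  - move=> x _; rewrite -poweR_EFin ger0_norm//; apply: gt0_ler_poweR.
    + exact: ltW.
    + by rewrite in_itv/= leey andbT lee_fin.
    + by rewrite in_itv/= leey andbT.
    + exact: lip_reg_leG.
apply: (@le_trans _ _ (Lp_norm m p (fun x => (\1_Y x * excess x + \1_Y x * deficit j x)%:E))).
  apply: (le_Lnorm _ p0).
  - apply/measurable_EFinP; apply: measurable_funM; first exact: measurable_indic.
    exact: measurable_funB.
  - by apply/measurable_EFinP; apply: measurable_funD;
      apply: measurable_funM => //; exact: measurable_indic.
  - move=> x; rewrite /= lee_fin indicE.
    have [Yx|Yx] := boolP (x \in Y); last by rewrite !mul0r addr0.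
    rewrite !mul1r (le_trans (err j x _))//; first by rewrite inE in Yx.
    exact: ler_norm.
rewrite (splitr e) EFinD; apply: le_trans (leeD Ne1 Nj).
apply: (eminkowski mu _ _ _).
- by apply: measurable_funM => //; exact: measurable_indic.
- by apply: measurable_funM => //; exact: measurable_indic.
- by rewrite lee_fin.
Qed.

End bounded_approximation.

(** * From chain upper gradients to Lipschitz ones *)

Section lipschitz_competitor.
Context {R : realType} {X : metricPType R}.
Variables (m : {outer_measure set X -> \bar R}) (p : R) (p1 : (1 <= p%:E)%E).
Hypothesis rm : radon m.
Hypothesis bm : forall A, metric_bounded A -> (m A < +oo)%E.
Local Notation T := (caratheodory_type m).
Local Notation mu := (cara_measure m).
Local Notation o := (point : X).
Local Notation "'N[ f ]" := (Lp_norm m p (EFin \o f)) (format "''N[' f ]").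
Implicit Types (u v w : Lfun_space m p1) (k : R) (x y : X) (f g : X -> R).

Let p0 : 0 < p. Proof. by rewrite (lt_le_trans ltr01)// -lee_fin. Qed.
Let p1' : 1 <= p. Proof. by rewrite -lee_fin. Qed.

Lemma F_C_ge0 v : (0 <= F_C m p1 v)%E.
Proof.
rewrite leNgt; apply/negP => /F_C_lt[eps [g [_ _]]].
by rewrite ltNge Lnorm_ge0.
Qed.

(** Let u be v truncated at K, and let f and w be the functions given by
    [lipschitz_pair_approx] on the ball Y of radius 2 K + 2.  The function cutoff K * w
    is close to cut K v, hence to v.  Only on Y is the norm of f controlled; as
    the cutoff vanishes at distance 2 K, its upper gradient f + |w| / K may be
    multiplied by a second cutoff chi supported in Y. *)
Lemma F_CLip_approx_C v (d : R) : 0 < d -> exists w,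
  (Lp_norm m p (fun x => (w x - v x)%:E) <= d%:E)%E /\
  (F_CLip m p1 w <= F_C m p1 v + d%:E)%E.
Proof.
move=> d0; have [->|Foo] := eqVneq (F_C m p1 v) +oo%E.
  by exists v; rewrite Lp_norm_subrr// lee_fin ltW// addye// leey.
have Ffin : F_C m p1 v \is a fin_num by rewrite ge0_fin_numE ?F_C_ge0// ltey.
have d4 : 0 < d / 4 by rewrite divr_gt0.
have d8 : 0 < d / 8 by rewrite divr_gt0.
have d2 : 0 < d / 2 by rewrite divr_gt0.
have [eps [g [eps0 ug gF]]] : exists eps (g : X -> \bar R), [/\ 0 < eps, UG eps v g &
    (Lp_norm m p g < F_C m p1 v + (d / 4)%:E)%E].
  by apply: F_C_lt; rewrite lteDl// lte_fin.
have [bg g0 _] := ug.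
have gfin : Lp_norm m p g \is a fin_num.
  rewrite ge0_fin_numE ?Lnorm_ge0// (lt_trans gF)// -(fineK Ffin).
  by rewrite -EFinD ltry.
pose N0 := fine (Lp_norm m p g).
have N00 : 0 <= N0 by rewrite fine_ge0// Lnorm_ge0.
pose c := (N0 + d / 4) `^ p.
have Nd : 0 < N0 + d / 4 by rewrite ltr_wpDl.
have c0 : 0 < c by rewrite powR_gt0.
have mg : measurable_fun setT (g : T -> \bar R) by exact: borel_cara.
have gc : (\int[mu]_x (g x `^ p) < c%:E)%E.
  have : (Lp_norm m p g < (N0 + d / 4)%:E)%E.
    by rewrite -(fineK gfin) -/N0 lte_fin ltrDl.
  rewrite /Lp_norm; move/(Lnorm_ltP _ p0 _ (ltW Nd)).
  by under eq_integral do rewrite gee0_abs//.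
near \oo => n.
have nA : (Lp_norm m p (fun x => (cut n.+1%:R v x - v x)%:E) <= (d / 2)%:E)%E.
  by near: n; exact: cut_approx.
have nB : ((n.+1%:R^-1)%:E * 'N[v] <= (d / 8)%:E)%E.
  by near: n; exact: near_Lp_norm_div.
pose K : R := n.+1%:R.
have K0 : 0 < K by [].
have K1 : 1 <= K by rewrite /K ler1n.
pose Y : set X := ball o (2 * K + 2).
have oY : open Y by exact: open_metric_ball.
have mYm : measurable (Y : set T) by exact: open_cara.
have mY : (m Y < +oo)%E by apply: bm; exists o, (2 * K + 2).
have YE x : (x \in Y) = (mdist o x < 2 * K + 2).
  by apply/idP/idP; rewrite inE /Y ballEmdist.
pose u x := truncr K (v x).
have uK x : `|u x| <= K by rewrite truncr_le// ltW.
have meas_u : measurable_fun setT (u : T -> R).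
  by apply: truncr_measurable; exact: Lfun_measurable.
have ugu x y : mdist x y <= eps ->
    (`|u x - u y|%:E <= (g x + g y) * (2^-1)%:E * (mdist x y)%:E)%E.
  move=> xy; apply: le_trans (UG_pair ug xy); rewrite lee_fin.
  by rewrite truncr_lip// ltW.
have gcY : (\int[mu]_(x in Y) (g x `^ p) < c%:E)%E.
  apply: le_lt_trans gc; apply: ge0_subset_integral => //.
  by apply: (measurableT_comp (measurable_poweR _)).
  by move=> x _; exact: poweR_ge0.
have [f [w [r [r01 [fL wL [A fA] wM] f0 wf [fc wu]]]]] :=
  lipschitz_pair_approx p1' rm oY mY K0 uK meas_u bg g0 eps0 ugu gcY c0 d8.
case/andP: r01 => r0 r1.
have mf := Lip_measurable rm fL.
have mw := Lip_measurable rm wL.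
have mv := Lfun_measurable v.
pose W x := cutoff K x * w x.
have WL : Lip W.
  apply: (@Lip_mul_bounded _ _ _ _ 1 K) => //; first exact: cutoff_Lip.
  by move=> x; have /andP[a0 a1] := cutoff_itv K x; rewrite ger0_norm.
have mW := Lip_measurable rm WL.
have mcut := cut_measurable rm K0 mv.
pose D x := w x - u x.
have mD : measurable_fun setT (D : T -> R) by exact: measurable_funB.
pose YD x := \1_Y x * D x.
have mYD : measurable_fun setT (YD : T -> R).
  by apply: measurable_funM => //; exact: measurable_indic.
have cutY x : cutoff K x <= \1_Y x.
  rewrite indicE YE; have /andP[a0 a1] := cutoff_itv K x; case: ltP => //= xK.
  by rewrite cutoff_eq0// (le_trans _ xK)// lerDl.
have WvD : (Lp_norm m p (fun x => (W x - v x)%:E) <= d%:E)%E.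
  apply: (le_trans (Lp_norm_triangle p1 mW mcut mv)).
  have dd : d = d / 2 + d / 2 by exact: splitr.
  rewrite [in leRHS]dd EFinD leeD//.
  apply: (@le_trans _ _ (d / 8)%:E); last by rewrite lee_fin; lra.
  apply: le_trans wu; apply: (Lp_norm_le p1 (measurable_funB mW mcut) mYD) => x.
  rewrite /= /W /cut /YD -mulrBr !normrM ler_wpM2r//.
  have /andP[a0 _] := cutoff_itv K x.
  by rewrite !ger0_norm// (le_trans a0).
have [W' WE] : exists W' : Lfun_space m p1, W = W'.
  apply: Lfun_of => //.
  have mWv : measurable_fun setT ((fun x => W x - v x) : T -> R).
    exact: measurable_funB.
  have : ('N[(fun x => (W x - v x) + v x)%R] <= d%:E + 'N[v])%E.
    by apply: (le_trans (Lp_normD p1 mWv mv)); rewrite leeD2r.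
  have -> : (fun x => W x - v x + v x) = W by apply/funext => x; rewrite subrK.
  by move=> /le_lt_trans; apply; rewrite lte_add_pinfty ?ltry// Lfun_norm_fin.
exists W'; rewrite -WE; split => //.
pose chi x := clamp01 (2 * K + 2 - mdist o x).
have chi01 x : 0 <= chi x <= 1 by rewrite clamp01_ge0 clamp01_le1.
have chi_Lip : Lip chi.
  exists 1 => x y; rewrite mul1r (le_trans (clamp01_lip _ _))//.
  have -> : 2 * K + 2 - mdist o x - (2 * K + 2 - mdist o y) = mdist o y - mdist o x.
    by ring.
  by rewrite (metric_sym x y) mdist_lip.
have chiY x : chi x <= \1_Y x.
  rewrite indicE YE; have /andP[a0 a1] := chi01 x; case: ltP => //= xK.
  by rewrite /chi clamp01_0// subr_le0.
pose h x := chi x * (f x + `|w x| / K).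
have hL : Lip h.
  apply: (@Lip_mul_bounded _ _ _ _ 1 (A + 1)) => //.
  - by apply: LipD => //; exact: Lip_div_norm.
  - by move=> x; have /andP[a0 a1] := chi01 x; rewrite ger0_norm.
  - move=> x; rewrite (le_trans (ler_normD _ _))// lerD//.
    by rewrite normrM normr_id (gtr0_norm (_ : 0 < K^-1)) ?invr_gt0// ler_pdivrMr// mul1r.
have h0 x : 0 <= h x.
  by have /andP[a0 _] := chi01 x; rewrite mulr_ge0// addr_ge0// divr_ge0// ltW.
have hpair x y : mdist x y <= r -> `|W x - W y| <= (h x + h y) / 2 * mdist x y.
  move=> xy; have xy1 : mdist x y <= 1 by exact: le_trans r1.
  have one z : mdist o z <= 2 * K + 1 -> h z = f z + `|w z| / K.
    by move=> zK; rewrite /h /chi clamp01_1 ?mul1r//; lra.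
  have both : (mdist o x <= 2 * K + 1) && (mdist o y <= 2 * K + 1) \/
              (2 * K <= mdist o x) && (2 * K <= mdist o y).
    exact/near_or_far/(le_trans (mdist_lip o x y)).
  case: both => /andP[xK yK]; last first.
    rewrite /W !cutoff_eq0// !mul0r subrr normr0 mulr_ge0 ?mdist_ge0//.
    by rewrite divr_ge0// addr_ge0.
  rewrite !one// /W.
  have /andP[a0 a1] := cutoff_itv K x; have /andP[b0 b1] := cutoff_itv K y.
  rewrite (le_trans (dist_mul_avg _ _ a0 b0))//.
  have h1 : (cutoff K x + cutoff K y) / 2 * `|w x - w y| <= (f x + f y) / 2 * mdist x y.
    rewrite (le_trans _ (wf x y xy))// ler_piMl//; lra.
  have h2 : (`|w x| + `|w y|) / 2 * `|cutoff K x - cutoff K y| <=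
      (`|w x| + `|w y|) / 2 * (mdist x y / K).
    by rewrite ler_wpM2l ?cutoff_lip// divr_ge0// addr_ge0.
  apply: (le_trans (lerD h1 h2)); rewrite le_eqVlt; apply/orP; left; apply/eqP.
  by field; rewrite gt_eqF.
have lug : LUG r W' (EFin \o h).
  split; last by exists h.
  apply: pair_UG; first exact: Lip_borel.
    by move=> x; rewrite lee_fin.
  by move=> x y xy; rewrite /= -EFinD -!EFinM lee_fin -WE; exact: hpair.
have WL' : Lip W' by rewrite -WE.
apply: (le_trans (F_CLip_le WL' r0 lug)).
have mh := Lip_measurable rm hL.
pose Yf x := \1_Y x * f x; pose vK x := K^-1 * `|v x|.
have mYf : measurable_fun setT (Yf : T -> R).
  by apply: measurable_funM => //; exact: measurable_indic.
have mvK : measurable_fun setT (vK : T -> R).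
  by apply: measurable_funM; [exact: measurable_cst|exact: measurableT_comp].
have maD : measurable_fun setT ((fun x => `|YD x|) : T -> R).
  exact: measurableT_comp.
have hle x : `|h x| <= `|Yf x + `|YD x| + vK x|.
  rewrite ger0_norm// (le_trans _ (ler_norm _))// /h /Yf /YD /vK.
  have /andP[a0 a1] := chi01 x.
  have i0 : 0 <= \1_Y x :> R by rewrite (le_trans a0).
  rewrite normrM (ger0_norm i0) mulrDr -addrA lerD//; first by rewrite ler_wpM2r.
  have wle : `|w x| / K <= `|D x| + K^-1 * `|v x|.
    have : `|w x| <= `|D x| + `|v x|.
      rewrite (le_trans _ (lerD (lexx _) (truncr_norm _ (ltW K0))))// -/(u x).
      by rewrite (le_trans _ (ler_normD _ _))// /D subrK.
    move=> wx; rewrite (le_trans (ler_pM _ _ wx (lexx _)))//.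
      by rewrite invr_ge0 ltW.
    rewrite mulrDl (mulrC (`|v x|)) lerD2r ler_piMr// invf_le1//.
  have vK0 : 0 <= K^-1 * `|v x| by rewrite mulr_ge0// invr_ge0 ltW.
  rewrite (le_trans (ler_wpM2l a0 wle))// mulrDr lerD//; first by rewrite ler_wpM2r.
  by rewrite ler_piMl.
apply: (le_trans (Lp_norm_le p1 mh (measurable_funD (measurable_funD mYf maD) mvK) hle)).
apply: (le_trans (Lp_normD p1 (measurable_funD mYf maD) mvK)).
apply: (@le_trans _ _ (((N0 + d / 4)%:E + (d / 8)%:E) + (d / 8)%:E)%E).
  rewrite leeD//; last by rewrite Lp_norm_div.
  apply: (le_trans (Lp_normD p1 mYf maD)); rewrite leeD//.
    by apply: Lnorm_indic_le => //; exact: ltW.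
  by apply: le_trans wu; rewrite -[leRHS](Lnorm_abse mu).
have NF : N0 <= fine (F_C m p1 v) + d / 4.
  by rewrite -lee_fin EFinD !fineK// ltW.
by rewrite -(fineK Ffin) -!EFinD lee_fin; lra.
Unshelve. all: by end_near. Qed.

End lipschitz_competitor.

(** * The three spaces agree *)

Local Open Scope ereal_scope.

Theorem theorem1p2 (R : realType) (X : metricPType R)
    (m : {outer_measure set X -> \bar R}) (p : R) (p1 : 1 <= p%:E)
    (mms : is_metric_measure_space m) :
  (H_space (F_CLip m p1) = H_space (F_C m p1) /\
   H_space (F_C m p1) = H_space (F_AGS m p1)) /\
  (forall u : Lp_space m p1,
     H_norm (F_CLip m p1) u = H_norm (F_C m p1) u /\
     H_norm (F_C m p1) u = H_norm (F_AGS m p1) u).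
Proof.
have [_ _ rm bm] := mms.
have AC u : relaxation (F_AGS m p1) u <= relaxation (F_CLip m p1) u.
  apply: relaxation_le => v d d0; exists v; rewrite Lp_norm_subrr// lee_fin ltW//.
  split => //; apply: (le_trans (F_AGS_le_CLip rm v)).
  by rewrite leeDl// lee_fin ltW.
have CC u : relaxation (F_CLip m p1) u <= relaxation (F_C m p1) u.
  by apply: relaxation_le => v d d0; exact: F_CLip_approx_C.
have CA u : relaxation (F_C m p1) u <= relaxation (F_AGS m p1) u.
  by apply: relaxation_le => v d d0; exact: F_C_approx_AGS.
have E1 u : relaxation (F_CLip m p1) u = relaxation (F_C m p1) u.
  by apply/eqP; rewrite eq_le CC (le_trans (CA u) (AC u)).
have E2 u : relaxation (F_C m p1) u = relaxation (F_AGS m p1) u.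
  by apply/eqP; rewrite eq_le CA (le_trans (AC u) (CC u)).
split; last by move=> u; rewrite /H_norm E1 E2.
by split; apply/seteqP; split => u; rewrite /H_space /= ?E1 ?E2.
Qed.
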